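(* Let $p$ be a prime and $\alpha,\beta$ integers different from $1$, and assume that either $p>3$, or $p=3$ and neither $\alpha$ nor $\beta$ is congruent to $7$ modulo $9$. Suppose $v_p(\alpha-1)=v_p(\beta-1)=m>0$ and that $\ell=v_p(\alpha-\beta)$ satisfies $m<\ell<2m$ and $2\ell>3m$. Then $|G_p|=p^{5m+\ell}$, the nilpotency class of $G_p$ is $5$, $o(a)=o(b)=p^{m+\ell}$ and $o(c)=p^{2m}$.
   Context: $G(\alpha,\beta)=\langle A,B\mid A^{[A,B]}=A^{\alpha},\ B^{[B,A]}=B^{\beta}\rangle$ with $[x,y]=x^{-1}y^{-1}xy$, $y^x=x^{-1}yx$, and $C=[A,B]$. The group $G(\alpha,\beta)$ is finite and nilpotent, hence the direct product of its Sylow subgroups; $G_p$ denotes its Sylow $p$-subgroup and $a,b,c$ denote the images of $A,B,C$ under the canonical projection $G(\alpha,\beta)\to G_p$. $v_p$ is the $p$-adic valuation and $o(x)$ the order of $x$. *)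

(* Defs.v *)
From mathcomp Require Import all_boot all_order all_algebra all_fingroup all_solvable.
Set Implicit Arguments. Unset Strict Implicit. Unset Printing Implicit Defensive.

Local Open Scope group_scope.

Definition zexpg (gT : finGroupType) (x : gT) (k : int) : gT :=
  match k with Posz n => x ^+ n | Negz n => x ^- n.+1 end.

(* the defining relations  x^[x,y] = x^alpha,  y^[y,x] = y^beta
   (MathComp: [~ x, y] = x^-1 y^-1 x y and x ^ y = y^-1 x y, as in the paper) *)
Definition GRel (gT : finGroupType) (alpha beta : int) (x y : gT) : bool :=
  (x ^ [~ x, y] == zexpg x alpha) && (y ^ [~ y, x] == zexpg y beta).

(* G, with distinguished elements A B, is (a copy of) the finite group
   G(alpha,beta) = < A, B | A^[A,B] = A^alpha, B^[B,A] = B^beta >: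
   it is generated by A, B satisfying the relations, and has the universal
   property of the presentation with respect to all finite groups. *)
Definition is_Gab (gT : finGroupType) (alpha beta : int)
    (G : {group gT}) (A B : gT) : Prop :=
  [/\ G :=: <<[set A; B]>>, GRel alpha beta A B &
      forall (hT : finGroupType) (x y : hT), GRel alpha beta x y ->
        exists f : {morphism G >-> hT}, f A = x /\ f B = y].

(* Main.v *)
(** Write [alpha = 1 + x], [beta = 1 + y], [C = [A, B]].  The relations give
    [A^B = A C], [C^B = B^y C] and [(A^n)^B = C^n A^(alpha + ... + alpha^n)].

    Nilpotency: every prime dividing the order of [A] divides [x]; if [N] is the
    least positive integer with [A^N = B^N = 1] and [q] is a prime factor of [N],
    then [C^(N/q)] is central, and if it is trivial, [A^(N/q)] and [B^(N/q)] are
    central.  So the centre of [G] is not trivial, and one passes to the quotient.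

    Upper bound: conjugating [A^C = A^alpha] by [B] gives
    [C^(x - y) = B^g A^f] with [f], [g] of valuation [2m].  Conjugating this by
    [A], [B] and [C] yields [A^(p^(3m)) = B^(p^(3m)) = 1] and expresses [C^f] and
    [C^g] as powers of [B] and [A] with exponents of valuation [m + l]; taking a
    suitable power of the key relation and using [2l > 3m], all of them vanish.
    Since [G_p = <a><b><c>] and [a^f] lies in [<b><c>], the order is at most
    [p^(2m) p^(m+l) p^(2m)].

    Lower bound: a group of that order is built from an abelian group [V], generated
    by what will be [A^(p^m)], [B^(p^m)] and [C^(p^m)], by adjoining successively
    [C], [A] and [B] as cyclic extensions of degree [p^m].  The orders and the
    nilpotency class are read off in this group. *)

From HB Require Import structures.
Require Import Defs.
From mathcomp Require Import all_boot all_order all_algebra all_fingroup all_solvable.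
From mathcomp Require Import ring zify.
Import GRing.Theory.
Set Implicit Arguments. Unset Strict Implicit. Unset Printing Implicit Defensive.

(** * Geometric sums *)

(** The two bounds meet through the universal property: the group [T] of the lower bound satisfies
    the relations, so [G] maps onto it; [G] being nilpotent, a Sylow p-subgroup already maps onto
    [T], and the upper bound makes this map injective. The base of [T] is dictated by the upper
    bound. Put N = p^m, L = p^l, x = N u, y = N v, D = u - v, and write a, b, c for A^N, B^N, C^N
    additively. The orders to be reached say L a = L b = N c = 0, and the key relation becomes D c =
    (N/2)(u^2 a + v^2 b). This leaves N L N elements, and three extensions of degree N give
    p^(5m+l). The hypotheses enter as divisibilities. From m < l, u and v agree modulo p. From l <
    2m, L divides N^2, and also N 'C(N, 3) even for p = 3. From 2l > 3m, N divides (L/N)^2, which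
    lets b keep order L. The prime 2 cannot be set aside in the nilpotency proof, where [G] is not
    yet a p-group; hence the doubled divisibility for [geo2] and the argument with involutions. *)

Definition geo (a n : nat) : nat := \sum_(k < n) a ^ k.
Definition geo2 (a n : nat) : nat := \sum_(k < n) geo a k.
Definition geo3 (a n : nat) : nat := \sum_(k < n) geo2 a k.

Lemma geoS a n : geo a n.+1 = geo a n + a ^ n.
Proof. by rewrite /geo big_ord_recr. Qed.

Lemma geo2S a n : geo2 a n.+1 = geo2 a n + geo a n.
Proof. by rewrite /geo2 big_ord_recr. Qed.

Lemma geo3S a n : geo3 a n.+1 = geo3 a n + geo2 a n.
Proof. by rewrite /geo3 big_ord_recr. Qed.

Lemma geo0 a : geo a 0 = 0. Proof. exact: big_ord0. Qed.
Lemma geo20 a : geo2 a 0 = 0. Proof. exact: big_ord0. Qed.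
Lemma geo30 a : geo3 a 0 = 0. Proof. exact: big_ord0. Qed.

(** With [geo_geo2] and [geo2_geo3] this is the binomial expansion of (1+x)^n, truncated at third
    order without subtraction or division. *)
Lemma expS_geo x n : x.+1 ^ n = x * geo x.+1 n + 1.
Proof.
elim: n => [|n IH]; first by rewrite geo0 muln0.
by rewrite geoS mulnDr expnSr {1}IH !mulnS; lia.
Qed.

Lemma geo_geo2 x n : geo x.+1 n = n + x * geo2 x.+1 n.
Proof.
elim: n => [|n IH]; first by rewrite geo0 geo20 muln0.
by rewrite geoS geo2S expS_geo mulnDr {1}IH; lia.
Qed.

Lemma geo2_geo3 x n : geo2 x.+1 n = 'C(n, 2) + x * geo3 x.+1 n.
Proof.
elim: n => [|n IH]; first by rewrite geo20 geo30 muln0.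
by rewrite geo2S geo3S geo_geo2 binS bin1 IH mulnDr; lia.
Qed.

Lemma geoD a m n : geo a (m + n) = geo a m + a ^ m * geo a n.
Proof.
elim: n => [|n IH]; first by rewrite addn0 geo0 muln0 addn0.
by rewrite addnS !geoS IH expnD mulnDr addnA.
Qed.

Lemma geoM a m n : geo a (m * n) = geo a m * geo (a ^ m) n.
Proof.
elim: n => [|n IH]; first by rewrite muln0 !geo0 muln0.
by rewrite mulnS addnC geoD IH geoS mulnDr expnM [geo a m * (_ ^ n)]mulnC.
Qed.

Lemma geo2D a m n : geo2 a (m + n) = geo2 a m + n * geo a m + a ^ m * geo2 a n.
Proof.
elim: n => [|n IH]; first by rewrite addn0 geo20 muln0 !addn0.
by rewrite addnS !geo2S IH geoD mulnDr mulSn; lia.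
Qed.

Lemma geo2M a m n :
  geo2 a (m * n) = m * geo a m * geo2 (a ^ m) n + geo (a ^ m) n * geo2 a m.
Proof.
elim: n => [|n IH]; first by rewrite muln0 geo20 geo0 geo20 muln0 mul0n.
rewrite mulnS addnC geo2D IH geoS geo2S geoM expnM.
by ring.
Qed.

Lemma geo_prime_dvd q x : q %| x -> q %| geo x.+1 q.
Proof. by move=> qx; rewrite geo_geo2 dvdn_add // dvdn_mulr. Qed.

Lemma expS_succ x m : exists2 y, x.+1 ^ m = y.+1 & forall q, q %| x -> q %| y.
Proof.
exists (x * geo x.+1 m); first by rewrite expS_geo addn1.
by move=> q qx; rewrite dvdn_mulr.
Qed.

(** Split off the least prime factor q of n: the sum of length q k is the sum of length q times a
    sum of length k with base (1+x)^q. The first factor is q modulo x, and (1+x)^q - 1 inherits the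
    prime divisors of x. *)
Lemma dvdn_geo n x :
  0 < n -> (forall q, prime q -> q %| n -> q %| x) -> n %| geo x.+1 n.
Proof.
elim/ltn_ind: n x => n IH x n0 H.
have [n1|n1] := leqP n 1; first by rewrite (_ : n = 1) ?dvd1n //; lia.
have /dvdnP[k def_n] := pdiv_dvd n.
have q_pr := pdiv_prime n1; set q := pdiv n in def_n q_pr.
have k0 : 0 < k by move: n0; rewrite def_n muln_gt0 => /andP[].
have [y Ey Hy] := expS_succ x q.
have -> : geo x.+1 n = geo x.+1 q * geo y.+1 k.
  by rewrite -Ey -geoM mulnC -def_n.
rewrite [X in X %| _]def_n [k * q]mulnC dvdn_mul //.
  by apply: geo_prime_dvd; apply: H; rewrite // pdiv_dvd.
apply: IH => //; first by rewrite def_n -[X in X < _]muln1 ltn_pmul2l // prime_gt1.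
by move=> r r_pr rk; apply: Hy; apply: H => //; rewrite def_n dvdn_mulr.
Qed.

(** The same splitting; the factor 2 pays for q = 2, where [geo2] is 'C(2, 2) = 1 modulo x. *)
Lemma dvdn_geo2 n x :
  0 < n -> (forall q, prime q -> q %| n -> q %| x) -> n %| 2 * geo2 x.+1 n.
Proof.
elim/ltn_ind: n x => n IH x n0 H.
have [n1|n1] := leqP n 1; first by rewrite (_ : n = 1) ?dvd1n //; lia.
have /dvdnP[k def_n] := pdiv_dvd n.
have q_pr := pdiv_prime n1; set q := pdiv n in def_n q_pr.
have k0 : 0 < k by move: n0; rewrite def_n muln_gt0 => /andP[].
have qx : q %| x by apply: H; rewrite // pdiv_dvd.
have [y Ey Hy] := expS_succ x q.
have kq : k < n by rewrite def_n -[X in X < _]muln1 ltn_pmul2l // prime_gt1.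
have Hk r : prime r -> r %| k -> r %| y.
  by move=> r_pr rk; apply: Hy; apply: H => //; rewrite def_n dvdn_mulr.
have -> : 2 * geo2 x.+1 n =
    q * (geo x.+1 q * (2 * geo2 y.+1 k)) + 2 * geo2 x.+1 q * geo y.+1 k.
  by rewrite -Ey [in LHS]def_n [k * q]mulnC geo2M; ring.
rewrite [X in X %| _]def_n [k * q]mulnC dvdn_add ?dvdn_mul //.
- by rewrite dvdn_mull // IH.
- rewrite geo2_geo3 mulnDr dvdn_add //; last by rewrite mulnCA dvdn_mulr.
  by rewrite -[2]/(1.+1) -mul_bin_diag bin1 dvdn_mulr.
- exact: dvdn_geo.
Qed.

Lemma geoSl a n : geo a n.+1 = 1 + a * geo a n.
Proof. by rewrite -add1n geoD expn1 /geo big_ord_recr big_ord0 /= add0n. Qed.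

Lemma dvdn_geo_mull n m x :
  0 < n -> (forall q, prime q -> q %| n -> q %| x) -> n %| m -> n %| geo x.+1 m.
Proof. by move=> n0 nx /dvdnP[k ->]; rewrite [k * n]mulnC geoM dvdn_mulr ?dvdn_geo. Qed.

Lemma dvdn_geo2_mull n m x :
  0 < n -> (forall q, prime q -> q %| n -> q %| x) -> n %| m ->
  n %| 2 * geo2 x.+1 m.
Proof.
move=> n0 nx /dvdnP[k ->]; rewrite [k * n]mulnC geo2M mulnDr dvdn_add //.
  by rewrite mulnCA -mulnA dvdn_mulr.
by rewrite mulnCA dvdn_mull ?dvdn_geo2.
Qed.

Lemma geo3_bin x n : exists k, geo3 x.+1 n = 'C(n, 3) + x * k.
Proof.
elim: n => [|n [k IH]]; first by exists 0; rewrite geo30 muln0.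
by exists (k + geo3 x.+1 n); rewrite geo3S IH geo2_geo3 [in RHS]binS IH; ring.
Qed.

(* The exponent of A in the key relation [macd_key]; it is about x^2 / 2. *)
Definition fexp (x : nat) : nat := x.+1 ^ x.+1 - geo x.+1 x.+1.

Lemma fexp_geo x : 0 < x -> x.+1 ^ x.+1 = fexp x + geo x.+1 x.+1.
Proof. by move=> x0; rewrite subnK // expS_geo; nia. Qed.

Lemma fexp_double x : 0 < x ->
  2 * fexp x = x * x * (2 + x.-1 * (x.+1 + 2 * geo3 x.+1 x.+1)).
Proof.
move=> x0; have := fexp_geo x0; rewrite expS_geo.
have := geo_geo2 x x.+1; rewrite geo2_geo3.
have : 2 * 'C(x.+1, 2) = x.+1 * x by rewrite -[2]/(1.+1) -mul_bin_diag bin1.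
case: x x0 => // x _ /=; move: (geo _ _) (geo3 _ _) (fexp _) 'C(_, _) => s R F b.
nia.
Qed.

Lemma fexp_gt0 x : 0 < x -> 0 < fexp x.
Proof.
move=> x0; have : 0 < 2 * fexp x by rewrite fexp_double // !muln_gt0 x0.
by rewrite muln_gt0.
Qed.

Lemma logn_succ p x : prime p -> p %| x -> logn p x.+1 = 0.
Proof.
by move=> p_pr px; rewrite lognE -[x.+1]addn1 dvdn_addr // Euclid_dvd1 // !andbF.
Qed.

(** * Valuations of the sums at an odd prime *)

Section Valuation.
Variable p : nat.
Hypotheses (p_pr : prime p) (p_odd : odd p).

Lemma odd_prime_ndvd2 : ~~ (p %| 2).
Proof.
apply/negP => /(dvdn_leq (ltn0Sn _)); have := prime_gt1 p_pr.
by case: (p) p_odd => [|[|[|]]].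
Qed.

Lemma odd_dvd_double k n : p ^ k %| 2 * n -> p ^ k %| n.
Proof.
by rewrite Gauss_dvdr // coprimeXl // prime_coprime // odd_prime_ndvd2.
Qed.

Lemma pfactor_dvd_geo2 x n k : p %| x -> p ^ k %| n -> p ^ k %| geo2 x.+1 n.
Proof.
move=> px pn; apply: odd_dvd_double; apply: dvdn_geo2_mull => //.
  by rewrite expn_gt0 prime_gt0.
by move=> q q_pr; rewrite Euclid_dvdX // dvdn_prime2 // => /andP[/eqP->].
Qed.

Lemma pfactor_dvd_geo x n k : p %| x -> p ^ k %| n -> p ^ k %| geo x.+1 n.
Proof.
by move=> px pn; rewrite geo_geo2 dvdn_add // dvdn_mull // pfactor_dvd_geo2.
Qed.

(** In n + x geo2 the second term has larger valuation than n, since the p-part of n divides [geo2]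
    and p divides x. *)
Lemma logn_geo x n : p %| x -> 0 < n -> logn p (geo x.+1 n) = logn p n.
Proof.
move=> px n0; set k := logn p n.
have pk : p ^ k %| geo2 x.+1 n by rewrite pfactor_dvd_geo2 ?pfactor_dvdnn.
have [r cpr def_n] := pfactor_coprime p_pr n0.
have /dvdnP[t def_t] := pk.
have -> : geo x.+1 n = (r + x * t) * p ^ k.
  by rewrite geo_geo2 def_t [in LHS]def_n -/k; ring.
have rx : ~~ (p %| r + x * t).
  by rewrite dvdn_addl ?dvdn_mulr // -prime_coprime.
have r0 : 0 < r + x * t by rewrite lt0n; apply: contraNneq rx => ->.
by rewrite lognM ?expn_gt0 ?(prime_gt0 p_pr) // pfactorK // lognE (negPf rx) !andbF.
Qed.

Lemma geo_modp x n k : p %| x -> p ^ k %| n -> 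
  exists t, geo x.+1 n = n + p ^ k.+1 * t.
Proof.
move=> px pn; have := pfactor_dvd_geo2 px pn.
case/dvdnP=> t Et; have /dvdnP[s Es] := px; exists (s * t).
by rewrite geo_geo2 Et [X in _ + X * _]Es expnS; ring.
Qed.

(** In [fexp_double] the cofactor of x^2 is 1 modulo p as soon as p divides [geo3], which is 'C(x+1,
    3) modulo x. For p = 3 the denominator 6 of this binomial costs one factor 3, whence the
    assumption on p^2. *)
Lemma logn_fexp x : 0 < x -> p ^ 2 %| x -> logn p (fexp x) = 2 * logn p x.
Proof.
move=> x0 p2x; have px : p %| x by apply: dvdn_trans p2x; rewrite dvdn_mulr.
set w := 2 + x.-1 * (x.+1 + 2 * geo3 x.+1 x.+1).
have pR : p %| geo3 x.+1 x.+1.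
  have [k ->] := geo3_bin x x.+1; rewrite dvdn_add ?dvdn_mulr //.
  have C6 : 6 * 'C(x.+1, 3) = x.+1 * (x * x.-1).
    rewrite -[6]/(2 * 3) -mulnA -mul_bin_diag /= mulnCA.
    by rewrite -[2]/(1.+1) -mul_bin_diag bin1.
  have : p ^ 2 %| 6 * 'C(x.+1, 3) by rewrite C6 dvdn_mull ?dvdn_mulr.
  rewrite -[6]/(2 * 3) -mulnA => /odd_dvd_double.
  have [->|p3] := eqVneq p 3; first by rewrite expnS expn1 dvdn_pmul2l.
  rewrite Gauss_dvdr; first by apply: dvdn_trans; rewrite dvdn_mulr.
  by rewrite coprimeXl // prime_coprime // dvdn_prime2.
have pw : ~~ (p %| w).
  have -> : w = x * x + x.-1 * (2 * geo3 x.+1 x.+1) + 1.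
    by rewrite /w; case: (x) x0 => // n _ /=; ring.
  by rewrite dvdn_addr ?Euclid_dvd1 // dvdn_add // ?[p %| x * _]dvdn_mulr // mulnA dvdn_mull.
have w0 : 0 < w by [].
have : logn p (2 * fexp x) = logn p (x * x * w) by rewrite fexp_double.
have n2 : logn p 2 = 0 by rewrite lognE (negPf odd_prime_ndvd2) !andbF.
have nw : logn p w = 0 by rewrite lognE (negPf pw) !andbF.
rewrite !lognM ?muln_gt0 ?x0 // ?n2 ?nw; first by lia.
exact: fexp_gt0.
Qed.
End Valuation.

Local Open Scope group_scope.

(** * Consequences of the relations *)

Lemma conjX_expgM (gT : finGroupType) (a c : gT) k n :
  a ^ c = a ^+ k -> (a * c) ^+ n = c ^+ n * a ^+ (k * geo k n).
Proof.
move=> ac; have acE e : a ^+ e * c = c * a ^+ (k * e).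
  by rewrite conjgC conjXg ac expgM.
elim: n => [|n IH]; first by rewrite geo0 muln0 mulg1.
by rewrite expgSr IH -mulgA [_ * (a * c)]mulgA -expgSr acE mulgA -expgSr geoSl.
Qed.

Definition macd (gT : finGroupType) (x y : nat) (A B : gT) : Prop :=
  A ^ [~ A, B] = A ^+ x.+1 /\ B ^ [~ B, A] = B ^+ y.+1.

Lemma macd_sym (gT : finGroupType) x y (A B : gT) : macd x y A B -> macd y x B A.
Proof. by case. Qed.

Section Relations.
Variables (gT : finGroupType) (x y : nat) (A B : gT).
Hypothesis relAB : macd x y A B.
Let C := [~ A, B].

Lemma macd_conjAB : A ^ B = A * C.
Proof. by rewrite /C commgEl mulKVg. Qed.

Lemma macd_CB : C * B = B ^+ y.+1 * C.
Proof. by rewrite -relAB.2 conjgE -invg_comm -/C invgK -!mulgA mulVg mulg1. Qed.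

Lemma macd_conjAX n k : (A ^+ n) ^ (C ^+ k) = A ^+ (n * x.+1 ^ k)%N.
Proof.
elim: k => [|k IH]; first by rewrite expg0 conjg1 muln1.
by rewrite expgSr conjgM IH conjXg relAB.1 -expgM expnSr; congr (A ^+ _); ring.
Qed.

Lemma macd_AXC n k : A ^+ n * C ^+ k = C ^+ k * A ^+ (n * x.+1 ^ k)%N.
Proof. by rewrite conjgC macd_conjAX. Qed.

Lemma macd_conjAXB n : (A ^+ n) ^ B = C ^+ n * A ^+ (x.+1 * geo x.+1 n)%N.
Proof. by rewrite conjXg macd_conjAB (conjX_expgM _ relAB.1). Qed.

End Relations.

Section Relations2.
Variables (gT : finGroupType) (x y : nat) (A B : gT).
Hypothesis relAB : macd x y A B.
Let C := [~ A, B].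
Let relBA := macd_sym relAB.

(** Since B^(C^-1) = B^(1+y), C acts on <B> by the inverse power; placing the factor on the left
    avoids inverting 1+y modulo the order of B. *)
Lemma macd_conjBX n k : (B ^+ (n * y.+1 ^ k)%N) ^ (C ^+ k) = B ^+ n.
Proof. by rewrite -(macd_conjAX relBA) -invg_comm expVgn conjgKV. Qed.

Lemma macd_CBX n k : C ^+ k * B ^+ n = B ^+ (n * y.+1 ^ k)%N * C ^+ k.
Proof. by rewrite [RHS]conjgC macd_conjBX. Qed.

Lemma macd_conjBXA n : (B ^+ n) ^ A = C ^- n * B ^+ (y.+1 * geo y.+1 n)%N.
Proof. by rewrite (macd_conjAXB relBA) -invg_comm expVgn. Qed.

Lemma macd_conjCXB n : (C ^+ n) ^ B = B ^+ (y * geo y.+1 n)%N * C ^+ n.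
Proof.
elim: n => [|n IH]; first by rewrite geo0 muln0 expg0 conj1g mulg1.
have CB : C ^ B = B ^+ y * C.
  by apply: (mulgI B); rewrite -conjgC mulgA -expgS (macd_CB relAB).
have CBn : C * B ^+ (y * geo y.+1 n)%N = B ^+ (y * geo y.+1 n * y.+1)%N * C.
  by have := macd_CBX (y * geo y.+1 n) 1; rewrite expg1 expn1.
rewrite !expgS conjMg IH CB; move: (C) CBn => c CBn.
rewrite mulgA -[_ * c * _]mulgA CBn mulgA -expgD -mulgA geoSl.
by congr (B ^+ _ * _); ring.
Qed.

End Relations2.

Lemma macd_conjCXA (gT : finGroupType) x y (A B : gT) n : macd x y A B ->
  ([~ A, B] ^+ n) ^ A = [~ A, B] ^+ n * A ^- (x * geo x.+1 n)%N.
Proof.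
move/macd_sym => rel; have := macd_conjCXB rel n.
rewrite -invg_comm expVgn conjVg => /(canRL invgK) ->.
by rewrite [LHS]invMg invgK.
Qed.

Lemma ltn_totient n : 1 < n -> totient n < n.
Proof.
case: n => // n n1; rewrite totient_count_coprime big_nat_recl // /coprime gcdn0.
rewrite [n.+1 == 1%N]gtn_eqF // add0n ltnS.
apply: leq_trans (_ : \sum_(0 <= i < n) 1 <= n)%N; last by rewrite sum_nat_const_nat; lia.
by apply: leq_sum => i _; case: (_ == _).
Qed.

Lemma expg_eq_dvdn (gT : finGroupType) (a : gT) i j :
  i <= j -> (a ^+ j == a ^+ i) = (#[a] %| j - i).
Proof. by move=> ij; rewrite eq_expg_mod_order eqn_mod_dvd. Qed.

(** * The primes dividing the order of A *)

Section Relations.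
Variables (gT : finGroupType) (x y : nat) (A B : gT).
Hypothesis relAB : macd x y A B.
Let C := [~ A, B].

Lemma macd_normA : C \in 'N(<[A]>).
Proof. by rewrite inE -cycleJ cycle_subG relAB.1 mem_cycle. Qed.

Lemma macd_normB : C \in 'N(<[B]>).
Proof.
rewrite -groupV /C invg_comm.
by rewrite inE -cycleJ cycle_subG relAB.2 mem_cycle.
Qed.

Lemma macd_coprime : coprime #[A] x.+1.
Proof.
have := orderXgcd A x.+1; rewrite -relAB.1 orderJ => E.
have g0 : 0 < gcdn #[A] x.+1 by rewrite gcdn_gt0 order_gt0.
have /eqP := divnK (dvdn_gcdl #[A] x.+1); rewrite -E.
by rewrite -[X in _ == X]muln1 eqn_pmul2l ?order_gt0.
Qed.

(* A power of A lying in <[B]> commutes with B, hence with C = [A, B]. *)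
Lemma macd_capAB n : A ^+ n \in <[B]> -> #[A] %| n * x.
Proof.
move=> AnB; have cAnB : commute (A ^+ n) B.
  by apply/commute_sym; apply: (centsP (cycle_abelian B)); rewrite ?cycle_id.
have cAnC : commute (A ^+ n) C.
  have cAnA : commute (A ^+ n) A by apply/commute_sym; apply: commuteX.
  by rewrite /C commgEl conjgE; do ?[apply: commuteM | apply: commuteV].
have /eqP := macd_conjAX relAB n 1; rewrite expg1 expn1 -/C conjgE cAnC mulKg eq_sym.
by rewrite expg_eq_dvdn ?leq_pmulr // mulnS addKn.
Qed.

(* Split #[A] = n2 * n1, where n1 is its largest divisor prime to x.  For
   N = totient n1 * n2 the order of A divides 1 + ... + (x + 1)^(N - 1), so
   (A^N)^B = C^N, whence A^(N x) is in <[B]> and n1 divides totient n1. *)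
Lemma macd_order_primes q : prime q -> q %| #[A] -> q %| x.
Proof.
move: q; pose pi : nat_pred := [pred q | q %| x].
set n := #[A]; pose n1 := (n`_(pi^'))%N; pose n2 := (n`_pi)%N.
have n0 : 0 < n := order_gt0 A.
have def_n : (n2 * n1)%N = n by rewrite partnC.
have cn : coprime n2 n1 by rewrite coprime_partC.
have pr2 r : prime r -> r %| n2 -> r %| x.
  by move=> r_pr rn2; apply: (pnatP _ _ (part_pnat pi n)).
have c1x : coprime n1 x.
  rewrite /coprime eqn_leq gcdn_gt0 part_gt0 andbT leqNgt; apply/negP=> g1.
  have r_pr := pdiv_prime g1; have := pdiv_dvd (gcdn n1 x).
  rewrite dvdn_gcd => /andP[rn1 rx].
  by have := pnatP _ (part_gt0 _ _) (part_pnat pi^' n) _ r_pr rn1; rewrite !inE rx.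
pose N := (n2 * totient n1)%N.
have nN : n %| geo x.+1 N.
  rewrite -def_n Gauss_dvd // dvdn_geo_mull ?part_gt0 ?dvdn_mulr //=.
  have: n1 %| x.+1 ^ totient n1 - 1.
    rewrite -eqn_mod_dvd ?expn_gt0 //; apply/eqP/Euler_exp_totient.
    by rewrite coprime_sym; apply: coprime_dvdl macd_coprime; rewrite dvdn_part.
  rewrite expS_geo addnK Gauss_dvdr // => n1g.
  by rewrite /N mulnC geoM dvdn_mulr.
have ANB : (A ^+ N) ^ B = C ^+ N.
  rewrite (macd_conjAXB relAB); rewrite (_ : A ^+ _ = 1) ?mulg1 //.
  by apply/eqP; rewrite -order_dvdn dvdn_mull.
have [w Ew] : exists w, A ^+ N = B ^- w * C ^+ N.
  exists (y * geo y.+1 N)%N; apply: (conjg_inj B); rewrite ANB conjMg.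
  by rewrite (macd_conjCXB relAB) conjVg conjXg [B ^ B]conjgE !mulKg.
(* A^(N x) = (A^N)^C A^-N; here the factor C^N of A^N cancels, and what remains lies in <B>, which C
   normalises. *)
have : A ^+ (N * x) \in <[B]>.
  have -> : A ^+ (N * x) = (A ^+ N) ^ C * (A ^+ N)^-1.
    rewrite -[C]expg1 (macd_conjAX relAB) expn1 mulnS addnC expgD mulgK //.
  rewrite Ew conjMg conjXg [C ^ C]conjgE mulKg invMg !invgK mulgA mulgK.
  by rewrite groupM ?mem_cycle // memJ_norm ?macd_normB // groupV mem_cycle.
move/macd_capAB; rewrite -/n => nNx q q_pr qn.
suffices n1_1 : n1 = 1%N by apply: pr2; rewrite // -[n2]muln1 -n1_1 def_n.
have: n1 %| totient n1.
  have := dvdn_trans (dvdn_part pi^' n) nNx; rewrite -/n1 Gauss_dvdl //.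
  by rewrite Gauss_dvdl // Gauss_dvdr // coprime_sym.
apply: contraTeq; rewrite neq_ltn => /orP[|n1_gt1].
  by rewrite ltnS leqn0 => /eqP n1_0; have := part_gt0 pi^' n; rewrite -/n1 n1_0.
by rewrite gtnNdvd ?ltn_totient // totient_gt0 ltnW.
Qed.

End Relations.

(** * Nilpotency *)

(** A cyclic group has a single involution. In the nilpotency proof this identifies A^N with the
    error term that may survive at the prime 2. *)
Lemma expg_involution (gT : finGroupType) (a : gT) i :
  a ^+ i != 1 -> a ^+ (2 * i) = 1 -> a ^+ i = a ^+ (#[a] %/ 2).
Proof.
rewrite -order_dvdn => ni /eqP; rewrite -order_dvdn => n2i.
have n2 : 2 %| #[a].
  apply: contraNT ni; rewrite -prime_coprime // coprime_sym => c2.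
  by rewrite -(Gauss_dvdr _ c2).
have /dvdnP[k Ek] := n2; rewrite Ek mulnK //.
have k0 : 0 < k by have := order_gt0 a; rewrite Ek muln_gt0 => /andP[].
move: n2i ni; rewrite Ek mulnC dvdn_pmul2l // => /dvdnP[t ->].
rewrite mulnC [(t * k)%N]mulnC dvdn_pmul2l // dvdn2 negbK => odd_t.
rewrite -[t]odd_double_half odd_t mulnDr muln1 expgD -mul2n mulnA -Ek expgM.
by rewrite expg_order expg1n mulg1.
Qed.

Section Center.
Variables (gT : finGroupType) (x y : nat) (A B : gT).
Hypothesis relAB : macd x y A B.
Let C := [~ A, B].
Variables N q : nat.
Hypotheses (q_pr : prime q) (N0 : 0 < N) (ANq : #[A] %| N * q).

(** If q divides the order of A then q divides x, which supplies the factor that N lacks; otherwise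
    the order already divides N. *)
Let order_dvd_geo z :
    (forall n, 0 < n -> (forall r, prime r -> r %| n -> r %| x) ->
      n %| N -> n %| z) ->
  #[A] %| x * z.
Proof.
move=> Hz; pose g := gcdn #[A] N.
have g0 : 0 < g by rewrite gcdn_gt0 N0 orbT.
have gz : g %| z.
  apply: Hz; rewrite ?dvdn_gcdr // => r r_pr rg.
  by apply: (macd_order_primes relAB r_pr); apply: dvdn_trans rg (dvdn_gcdl _ _).
have [qA|qA] := boolP (q %| #[A]).
  apply: dvdn_trans (_ : q * g %| _); last first.
    by rewrite dvdn_mul // (macd_order_primes relAB).
  by rewrite muln_gcdr dvdn_gcd dvdn_mull // mulnC.
rewrite dvdn_mull //; apply: dvdn_trans gz; rewrite dvdn_gcd dvdnn /=.
by rewrite -(Gauss_dvdl _ (p := q)) // coprime_sym prime_coprime.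
Qed.

Lemma macd_dvd_geo : #[A] %| x * geo x.+1 N.
Proof. by apply: order_dvd_geo => n *; apply: dvdn_geo_mull. Qed.

Lemma macd_dvd_geo2 : #[A] %| x * (2 * geo2 x.+1 N).
Proof. by apply: order_dvd_geo => n *; apply: dvdn_geo2_mull. Qed.

Lemma macd_centA : A ^ (C ^+ N) = A.
Proof.
rewrite -[A in A ^ _]expg1 (macd_conjAX relAB) mul1n expS_geo expgD.
by rewrite (eqP (_ : A ^+ _ == 1)) ?mul1g // -order_dvdn macd_dvd_geo.
Qed.

Hypothesis CN1 : C ^+ N = 1.

Lemma macd_conjAN : (A ^+ N) ^ B = A ^+ N * A ^+ (x * geo2 x.+1 N).
Proof.
rewrite (macd_conjAXB relAB) -/C CN1 mul1g mulSn expgD mulnC.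
rewrite [A ^+ (geo _ _ * _)](eqP (_ : _ == 1)) ?mulg1; last first.
  by rewrite -order_dvdn mulnC macd_dvd_geo.
by rewrite geo_geo2 expgD.
Qed.

Hypothesis center1 : forall z, z ^ A = z -> z ^ B = z -> z \in <[A]> -> z = 1.

(** Conjugation by B multiplies A^N by w = A^(x geo2), where w^2 = 1. So A^(2N) is central, hence
    trivial. If w = 1, then A^N is central too. If A^N and w were both nontrivial, they would be the
    same involution, and A^N would be conjugate to A^N w = 1. *)
Lemma macd_expAN : A ^+ N = 1.
Proof.
have AA i : (A ^+ i) ^ A = A ^+ i by rewrite conjXg conjgE mulKg.
have A2N : A ^+ (2 * N) = 1.
  apply: center1; rewrite ?mem_cycle // mulnC expgM conjXg macd_conjAN -!expgM.
  rewrite expgMn; last exact: commuteX2.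
  rewrite -expgM -[X in _ * X]expgM -mulnA [(_ * 2)%N in X in _ * X]mulnC.
  by rewrite [X in _ * X](eqP (_ : _ == 1)) ?mulg1 // -order_dvdn macd_dvd_geo2.
have [//|AN] := eqVneq (A ^+ N) 1.
apply: center1; rewrite ?mem_cycle // macd_conjAN.
have [->|nw] := eqVneq (A ^+ (x * geo2 x.+1 N)) 1; first by rewrite mulg1.
case/eqP: (AN); apply: (conjg_inj B); rewrite conj1g macd_conjAN.
have w2 : A ^+ (2 * (x * geo2 x.+1 N)) = 1.
  by apply/eqP; rewrite -order_dvdn mulnCA macd_dvd_geo2.
by rewrite (expg_involution nw w2) -(expg_involution AN A2N) -expgD addnn -mul2n.
Qed.

End Center.

Lemma macd_center_neq1 (gT : finGroupType) (G : {group gT}) x y (A B : gT) :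
  G :=: <<[set A; B]>> -> macd x y A B -> G :!=: 1 -> 'Z(G) != 1.
Proof.
move=> defG relAB; apply: contraNneq => Z1.
have AG : A \in G by rewrite defG mem_gen // !inE eqxx.
have BG : B \in G by rewrite defG mem_gen // !inE eqxx orbT.
have center1 z : z ^ A = z -> z ^ B = z -> z \in G -> z = 1.
  move=> zA zB zG; apply/set1P; rewrite -[[set 1]]/(1 : {set gT}) -Z1 inE zG defG cent_gen.
  apply/centP=> t; rewrite !inE => /orP[]/eqP->; apply/commgP.
    by rewrite -conjg_fix zA.
  by rewrite -conjg_fix zB.
pose N := lcmn #[A] #[B].
have N0 : 0 < N by rewrite lcmn_gt0 !order_gt0.
have [N_le1|N1] := leqP N 1.
  have N1 : N = 1%N by apply/eqP; rewrite eqn_leq N_le1.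
  have := dvdn_lcml #[A] #[B]; have := dvdn_lcmr #[A] #[B].
  rewrite -/N N1 !dvdn1 !order_eq1 => /eqP B1 /eqP A1.
  by rewrite defG A1 B1 setUid; apply/eqP/trivgP; rewrite gen_subG.
have q_pr := pdiv_prime N1; have /dvdnP[M def_N] := pdiv_dvd N.
set q := pdiv N in q_pr def_N.
have M0 : 0 < M by move: N0; rewrite def_N muln_gt0 => /andP[].
have AMq : #[A] %| M * q by rewrite -def_N dvdn_lcml.
have BMq : #[B] %| M * q by rewrite -def_N dvdn_lcmr.
have CM : [~ A, B] ^+ M = 1.
  apply: center1; last by rewrite groupX ?groupR.
    apply/conjg_fixP; rewrite commg1_sym; apply/conjg_fixP.
    exact: macd_centA relAB _ _ q_pr M0 AMq.
  apply/conjg_fixP; rewrite commg1_sym; apply/conjg_fixP.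
  have := macd_centA (macd_sym relAB) q_pr M0 BMq.
  by rewrite -invg_comm expVgn => E; rewrite -{1}E conjgKV.
have CM' : [~ B, A] ^+ M = 1 by rewrite -invg_comm expVgn CM invg1.
have AM : A ^+ M = 1.
  apply: (macd_expAN relAB q_pr M0 AMq CM) => z zA zB zG.
  by apply: center1 => //; move: zG; apply/subsetP; rewrite cycle_subG.
have BM : B ^+ M = 1.
  apply: (macd_expAN (macd_sym relAB) q_pr M0 BMq CM') => z zA zB zG.
  by apply: center1 => //; move: zG; apply/subsetP; rewrite cycle_subG.
have : N %| M by rewrite dvdn_lcm !order_dvdn AM BM !eqxx.
by rewrite gtnNdvd // def_N -[X in X < _]muln1 ltn_pmul2l // prime_gt1.
Qed.

Lemma macd_morph (aT rT : finGroupType) (D : {group aT}) (f : {morphism D >-> rT})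
    x y A B :
  A \in D -> B \in D -> macd x y A B -> macd x y (f A) (f B).
Proof.
move=> AD BD [rA rB].
by split; rewrite -morphR // -morphJ ?groupR // (rA, rB) morphX.
Qed.

Lemma morphim_gen2 (aT rT : finGroupType) (D : {group aT})
    (f : {morphism D >-> rT}) A B :
  A \in D -> B \in D -> f @* <<[set A; B]>> = <<[set f A; f B]>>.
Proof.
move=> AD BD; rewrite morphim_gen ?subUset ?sub1set ?AD // morphimU.
by rewrite !morphim_set1.
Qed.

Lemma quotient_gen2 (gT : finGroupType) (G : {set gT}) (H : {group gT}) A B :
    G = <<[set A; B]>> -> A \in 'N(H) -> B \in 'N(H) ->
  G / H = <<[set coset H A; coset H B]>>.
Proof. by move=> -> nA nB; apply: morphim_gen2. Qed.

Lemma macd_nilpotent (gT : finGroupType) (G : {group gT}) x y (A B : gT) :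
  G :=: <<[set A; B]>> -> macd x y A B -> nilpotent G.
Proof.
have [n] := ubnP #|G|; elim: n gT G A B => // n IH gT G A B cardG defG relAB.
have [-> //|ntG] := eqVneq (G : {set gT}) 1; first exact: nilpotent1.
rewrite -quotient_center_nil.
have AG : A \in G by rewrite defG mem_gen // !inE eqxx.
have BG : B \in G by rewrite defG mem_gen // !inE eqxx orbT.
have nZ := normal_norm (center_normal G).
have [nA nB] := (subsetP nZ A AG, subsetP nZ B BG).
apply: (IH _ _ (coset _ A) (coset _ B)); last exact: macd_morph.
  rewrite -ltnS; apply: leq_trans cardG; rewrite ltnS ltn_quotient ?center_sub //.
  exact: macd_center_neq1 defG relAB ntG.
exact: quotient_gen2.
Qed.

(** * The upper bound *)

Lemma p_elt_expg_root (gT : finGroupType) (H : {group gT}) (p : nat) (a : gT) k :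
  p.-elt a -> coprime p k -> a ^+ k \in H -> a \in H.
Proof.
move=> pa cpk akH; have [e oa] := p_natP pa.
have ca : coprime #[a] k by rewrite oa coprimeXl.
have : generator <[a]> (a ^+ k) by rewrite generator_coprime.
rewrite /generator => /eqP E; rewrite -cycle_subG E cycle_subG //.
Qed.

Section Key.
Variables (gT : finGroupType) (x y : nat) (A B : gT).
Hypothesis relAB : macd x y A B.
Hypotheses (x0 : 0 < x) (y0 : 0 < y).
Let C := [~ A, B].

(** The relation C B = B^(1+y) C lets A ^ (C B) be computed in two ways. The exponents [fexp] are
    the excess of (1+y)^(1+y), resp. (1+x)^(1+x), over the geometric sum once the powers of C have
    been moved past B, resp. A. *)
Lemma macd_key :
  C ^+ x.+1 * A ^- fexp x = B ^+ (y.+1 * fexp y) * C ^+ y.+1.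
Proof.
have E1 : (A ^+ x.+1) ^ B = (A ^ (B ^+ y.+1)) ^ C.
  by rewrite -[A ^+ _]relAB.1 -!conjgM (macd_CB relAB).
have E2 : A ^ (B ^+ y.+1) = A * (B ^+ (y.+1 * fexp y) * C ^+ y.+1).
  rewrite [LHS](_ : _ = A * [~ A, B ^+ y.+1]); last by rewrite commgEl mulKVg.
  congr (A * _); rewrite commgEr conjVg (macd_conjBXA relAB) -/C.
  rewrite invMg invgK -mulgA (macd_CBX relAB) mulgA; congr (_ * _).
  apply: (mulgI (B ^+ (y.+1 * geo y.+1 y.+1))); rewrite mulKVg -expgD -mulnDr.
  by rewrite [(geo _ _ + _)%N]addnC -fexp_geo.
rewrite (macd_conjAXB relAB) -/C E2 in E1.
have E3 : C ^+ x.+1 * A ^+ geo x.+1 x.+1 = A * (B ^+ (y.+1 * fexp y) * C ^+ y.+1).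
  apply: (conjg_inj C); rewrite -E1 conjMg conjXg [C ^ C]conjgE mulKg.
  by rewrite -[X in _ ^ X]expg1 (macd_conjAX relAB) expn1 mulnC.
apply: (mulgI A); rewrite -{}E3 mulgA -[A in A * C ^+ _]expg1 (macd_AXC relAB).
by rewrite mul1n -mulgA fexp_geo // addnC expgD mulgK.
Qed.

Lemma macd_key_split : y < x ->
  exists j, C ^+ (x - y) = B ^+ (fexp y * y.+1 ^ j) * A ^+ fexp x.
Proof.
(* k represents -(1+y) modulo the order of C, so that conjugation by C^(1+y) multiplies the exponent
   of B by a natural power of 1+y. *)
move=> yx; pose k := (y.+1 * #[C].-1)%N.
exists k.+1; apply: (canRL (mulgKV (A ^+ fexp x))).
have Cy : C ^+ y.+1 = C ^- k.
  apply: (mulIg (C ^+ k)); rewrite mulVg -expgD -mulnS prednK ?order_gt0 //.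
  by rewrite mulnC expgM expg_order expg1n.
have := macd_key; have -> : C ^+ x.+1 = C ^+ y.+1 * C ^+ (x - y).
  by rewrite -expgD addSn subnKC // ltnW.
rewrite -mulgA => /(canRL (mulKg _)) ->.
rewrite -conjgE Cy; apply: (canLR (conjgK _)).
by rewrite -(macd_conjBX relAB _ k); congr (_ ^+ _ ^ _); rewrite expnS; ring.
Qed.

End Key.

(* T := <[A]> Y satisfies T <= B T because A^i B = B C^i A^j; the two sets have
   the same cardinal, so T is stable under left multiplication by A and B. *)
Lemma macd_prod (gT : finGroupType) (G : {group gT}) x y (A B : gT) :
  G :=: <<[set A; B]>> -> macd x y A B ->
  G \subset <[A]> * (<[B]> <*> <[[~ A, B]]>).
Proof.
move=> defG relAB; set C := [~ A, B]; pose Y := (<[B]> <*> <[C]>)%G.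
pose T := <[A]> * Y; rewrite -/T.
have BY : B \in Y by rewrite mem_gen // inE cycle_id.
have CY : C \in Y by rewrite mem_gen // inE cycle_id orbT.
have AT : A *: T = T by rewrite /T mulgA lcoset_id // cycle_id.
have BT : B *: T = T.
  apply/esym/eqP; rewrite eqEcard card_lcoset leqnn andbT.
  apply/subsetP=> _ /mulsgP[_ t /cycleP[i ->] tY ->].
  have [k Ek] : exists k, C ^+ i * A ^+ (x.+1 * geo x.+1 i) = A ^+ k * C ^+ i.
    have : (A ^+ (x.+1 * geo x.+1 i)) ^ (C ^- i) \in <[A]>.
      by rewrite memJ_norm ?mem_cycle // groupV groupX // (macd_normA relAB).
    by case/cycleP=> k Ek; exists k; rewrite conjgCV Ek.
  rewrite mem_lcoset -[t](mulKVg B) [A ^+ i * _]mulgA !mulgA -[_ * A ^+ i * B]mulgA.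
  rewrite -conjgE (macd_conjAXB relAB) Ek -!mulgA mem_mulg ?mem_cycle //.
  by rewrite groupM ?groupX // groupM ?groupV.
pose H := [set g | g *: T == T].
have gH : group_set H.
  apply/group_setP; split=> [|g h]; first by rewrite inE lcoset1.
  by rewrite !inE => /eqP gT1 /eqP hT1; rewrite lcosetM hT1 gT1.
have GH : G \subset Group gH.
  by rewrite defG gen_subG subUset !sub1set !inE AT BT !eqxx.
apply: subset_trans GH _; apply/subsetP=> g; rewrite inE => /eqP gT1.
rewrite -[g]mulg1 -gT1 mem_lcoset mulKg; apply/mulsgP.
by exists 1 1; rewrite ?mulg1 ?group1.
Qed.

Lemma logn_split p n k : prime p -> 0 < n -> logn p n = k ->
  exists2 n0, coprime p n0 & n = (p ^ k * n0)%N.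
Proof.
move=> p_pr n0 <-; have [r cpr def_n] := pfactor_coprime p_pr n0.
by exists r; rewrite // mulnC.
Qed.

Lemma p_elt_logn_expg (gT : finGroupType) (p : nat) (a : gT) n k :
  prime p -> p.-elt a -> 0 < n -> logn p n = k -> a ^+ n = 1 -> a ^+ (p ^ k) = 1.
Proof.
move=> p_pr pa n0 /(logn_split p_pr n0)[r cpr ->]; rewrite expgM => E.
apply/set1P; apply: (p_elt_expg_root (H := [1 gT]) _ cpr); last by rewrite E set11.
by apply: pnat_dvd pa; rewrite orderXdvd.
Qed.

Section Bound.
Variables (gT : finGroupType) (G : {group gT}) (p m l x y : nat) (A B : gT).
Hypotheses (p_pr : prime p) (p_odd : odd p) (pG : p.-group G).
Hypotheses (defG : G :=: <<[set A; B]>>) (relAB : macd x y A B).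
Hypotheses (y0 : 0 < y) (yx : y < x) (lx : logn p x = m) (ly : logn p y = m).
Hypotheses (lxy : logn p (x - y) = l) (m1 : 1 < m) (ml : m < l) (l2m : l < 2 * m).
Hypothesis (m3l2 : 3 * m < 2 * l).
Let C := [~ A, B].

Let x0 : 0 < x. Proof. exact: leq_trans yx. Qed.
Let p0 : 0 < p. Proof. exact: prime_gt0. Qed.
Let AG : A \in G. Proof. by rewrite defG mem_gen // !inE eqxx. Qed.
Let BG : B \in G. Proof. by rewrite defG mem_gen // !inE eqxx orbT. Qed.
Let CG : C \in G. Proof. exact: groupR. Qed.
Let pelt g : g \in G -> p.-elt g. Proof. exact: mem_p_elt. Qed.
Let px : p %| x. Proof. by rewrite -[p]expn1 pfactor_dvdn // lx; lia. Qed.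
Let py : p %| y. Proof. by rewrite -[p]expn1 pfactor_dvdn // ly; lia. Qed.
Let d0 : 0 < x - y. Proof. by rewrite subn_gt0. Qed.

Let root (H : {group gT}) g n k : g \in G -> 0 < n -> logn p n = k ->
  g ^+ n \in H -> g ^+ (p ^ k) \in H.
Proof.
move=> gG n0 /(logn_split p_pr n0)[r cpr ->]; rewrite expgM.
exact: p_elt_expg_root (pelt (groupX _ gG)) cpr.
Qed.

Let f := fexp x.
Let f0 : 0 < f. Proof. exact: fexp_gt0. Qed.
Let lf : logn p f = (2 * m)%N.
Proof. by rewrite logn_fexp ?lx // pfactor_dvdn // lx. Qed.

Let fy0 : 0 < fexp y. Proof. exact: fexp_gt0. Qed.

Let lfy : logn p (fexp y) = (2 * m)%N.
Proof. by rewrite logn_fexp ?ly // pfactor_dvdn // ly. Qed.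

Let key : exists2 g, 0 < g /\ logn p g = (2 * m)%N & C ^+ (x - y) = B ^+ g * A ^+ f.
Proof.
have [j Ej] := macd_key_split relAB x0 y0 yx.
exists (fexp y * y.+1 ^ j)%N => //; split; first by rewrite muln_gt0 fy0 expn_gt0.
rewrite lognM ?expn_gt0 // lfy lognX.
by rewrite logn_succ // muln0 addn0.
Qed.

Lemma macd_p_relations : exists g,
  [/\ 0 < g /\ logn p g = (2 * m)%N,
      C ^+ (x - y) = B ^+ g * A ^+ f,
      A ^+ (p ^ (3 * m)) = 1 /\ B ^+ (p ^ (3 * m)) = 1,
      C ^+ f = B ^+ (y * geo y.+1 (x - y)) &
      C ^+ g = A ^+ (x * geo x.+1 (x - y))].
Proof.
have [g [g0 lg] keyg] := key; exists g.
have cAf : (A ^+ f) ^ C = A ^+ f * A ^+ (f * x).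
  by rewrite -[C]expg1 (macd_conjAX relAB) expn1 mulnS expgD.
(* Conjugation by C fixes the left side of the key relation, so the changes of B^g and A^f must
   compensate. *)
have EAB : A ^+ (f * x) = (B ^- g) ^ C * B ^+ g.
  have := congr1 (conjg^~ C) keyg; rewrite conjMg cAf conjXg [C ^ C]conjgE mulKg keyg.
  rewrite conjVg => E; apply: (mulgI (B ^+ g ^ C)); rewrite mulKVg.
  by apply: (mulIg (A ^+ f)); rewrite E -mulgA -!expgD addnC.
have AB : A ^+ (f * x) \in <[B]>.
  by rewrite EAB groupM ?mem_cycle // memJ_norm ?(macd_normB relAB) // groupV mem_cycle.
have BA : B ^+ (g * y) \in <[A]>.
  have : (A ^+ (f * x)) ^ (C^-1) \in <[A]>.
    by rewrite memJ_norm ?mem_cycle // groupV (macd_normA relAB).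
  rewrite EAB conjMg conjgK -[B ^+ g in X in _ * X](macd_conjBX relAB g 1) expg1 conjgK.
  by rewrite expn1 mulnS expgD mulKg.
have A3 : A ^+ (p ^ (3 * m)) \in <[B]>.
  apply: root AB; rewrite ?muln_gt0 ?f0 // lognM // lf lx; lia.
have B3 : B ^+ (p ^ (3 * m)) \in <[A]>.
  apply: root BA; rewrite ?muln_gt0 ?g0 // lognM // lg ly; lia.
have geo3 z n : p %| z -> logn p z = m -> 0 < n -> logn p n = (2 * m)%N ->
    exists e, (z.+1 * geo z.+1 n = n + p ^ (3 * m) * e)%N.
  move=> pz lz n0 ln.
  have pn : p ^ (2 * m) %| n by rewrite pfactor_dvdn // ln.
  have pm : p ^ m %| z by have [->//|z0] := posnP z; rewrite pfactor_dvdn // lz.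
  have : p ^ (3 * m) %| z * (geo2 z.+1 n + geo z.+1 n).
    rewrite (_ : p ^ (3 * m) = p ^ m * p ^ (2 * m))%N; last by rewrite -expnD -mulSn.
    by rewrite dvdn_mul // dvdn_add ?pfactor_dvd_geo ?pfactor_dvd_geo2.
  by case/dvdnP=> e Ee; exists e; rewrite [(_ * e)%N]mulnC -Ee mulSn [X in (X + _)%N]geo_geo2; ring.
have [eA EA] := geo3 _ _ px lx f0 lf; have [eB EB] := geo3 _ _ py ly g0 lg.
(* The key relation conjugated by B. The surplus power of A has exponent a multiple of p^(3m), hence
   lies in <B>, and so does C^f. *)
have relB : C ^+ f * A ^+ (p ^ (3 * m) * eA) = B ^+ (y * geo y.+1 (x - y)).
  have Af : A ^+ f = B ^- g * C ^+ (x - y) by rewrite keyg mulKg.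
  apply: (mulIg (A ^+ f)); rewrite -mulgA -expgD addnC -EA -(macd_conjAXB relAB).
  rewrite {1}Af conjMg (macd_conjCXB relAB) -/C conjVg conjXg [B ^ B]conjgE mulKg keyg.
  by rewrite !mulgA; congr (_ * _); rewrite -mulgA -expgD addnC expgD mulKg.
have C2B : C ^+ (p ^ (2 * m)) \in <[B]>.
  apply: root f0 lf _ => //; rewrite -(mulgK (A ^+ (p ^ (3 * m) * eA)) (C ^+ f)) relB.
  by rewrite groupM ?mem_cycle // groupV expgM groupX.
have cCB n : C ^+ n \in <[B]> -> (C ^+ n) ^ B = C ^+ n.
  by case/cycleP=> i ->; rewrite conjXg conjgE mulKg.
have CgB : C ^+ g \in <[B]>.
  have [r _ ->] := logn_split p_pr g0 lg; rewrite expgM groupX //.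
have relA : A ^+ (x * geo x.+1 (x - y)) = B ^- (p ^ (3 * m) * eB) * C ^+ g.
  have E := congr1 (conjg^~ A) keyg.
  rewrite /= conjMg (macd_conjCXA _ relAB) -/C (macd_conjBXA relAB) -/C EB in E.
  rewrite conjXg [A ^ A]conjgE mulKg keyg in E.
  have {}E : B ^+ g * A ^- (x * geo x.+1 (x - y)) = C ^- g * B ^+ (g + p ^ (3 * m) * eB).
    apply: (mulIg (A ^+ f)); rewrite -E -!mulgA; congr (_ * _).
    by apply: commute_sym; apply: commuteV; apply: commuteX2.
  have cCgB : C ^+ g * B ^+ g = B ^+ g * C ^+ g.
    by rewrite conjgC conjXg; congr (_ * _); rewrite -conjXg; case/cycleP: CgB => i ->;
       rewrite conjgE -expgD addnC expgD mulKg.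
  move/(congr1 invg): E; rewrite !invMg !invgK => /(canRL (mulgKV _)) ->.
  by rewrite -mulgA cCgB mulgA expgD invMg mulgKV.
have C2A : C ^+ (p ^ (2 * m)) \in <[A]>.
  apply: root g0 lg _ => //; rewrite -(mulKg (B ^- (p ^ (3 * m) * eB)) (C ^+ g)) -relA.
  by rewrite invgK groupM ?mem_cycle // expgM groupX.
have lp2 : logn p (p ^ (2 * m)) = (2 * m)%N by rewrite pfactorK.
have p2m0 : 0 < p ^ (2 * m) by rewrite expn_gt0 p0.
have gg z : p %| z -> 0 < z -> logn p z = m ->
    0 < z * geo z.+1 (p ^ (2 * m)) /\ logn p (z * geo z.+1 (p ^ (2 * m))) = (3 * m)%N.
  move=> pz z0 lz; have g0' : 0 < geo z.+1 (p ^ (2 * m)).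
    by rewrite geo_geo2 addn_gt0 p2m0.
  by rewrite muln_gt0 z0 g0' lognM // lz logn_geo // lp2; split=> //; lia.
(* C^(p^(2m)) lies in <A>, so it centralises A; but it acts on A as the power (1+x)^(p^(2m)), whose
   difference from 1 has valuation 3m. *)
have A31 : A ^+ (p ^ (3 * m)) = 1.
  have [e0 le] := gg x px x0 lx.
  apply: (p_elt_logn_expg p_pr (pelt AG) e0 le); apply/eqP.
  have cAC : A ^ (C ^+ (p ^ (2 * m))) = A.
    by case/cycleP: C2A => i ->; rewrite conjgE -expgS expgSr mulKg.
  move: cAC; rewrite -{1}[A]expg1 (macd_conjAX relAB) mul1n expS_geo expgD expg1.
  by move/eqP; rewrite -[X in _ == X]mul1g (inj_eq (mulIg A)).
have B31 : B ^+ (p ^ (3 * m)) = 1.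
  have [e0 le] := gg y py y0 ly.
  apply: (p_elt_logn_expg p_pr (pelt BG) e0 le); apply/eqP.
  have := macd_conjBX relAB 1 (p ^ (2 * m)); rewrite -/C mul1n expS_geo expgD expg1.
  have cBC : B ^ (C ^+ (p ^ (2 * m))) = B.
    by case/cycleP: C2B => i ->; rewrite conjgE -expgS expgSr mulKg.
  by rewrite conjMg conjXg cBC => /eqP; rewrite -[X in _ == X]mul1g (inj_eq (mulIg B)).
split=> //.
  by move: relB; rewrite expgM A31 expg1n mulg1.
by rewrite relA expgM B31 expg1n invg1 mul1g.
Qed.

(** The key relation is raised to K = p^(l-m) eA eB. Then g K and f K are multiples of the exponents
    of B and A in the formulas for C^f and C^g, so both factors turn into powers of C. This equates
    C to a unit multiple of p^(2m) with C to a multiple of p^(2l-m), and 2l - m > 2m forces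
    C^(p^(2m)) = 1. *)
Lemma macd_p_orders : C ^+ (p ^ (2 * m)) = 1 /\ B ^+ (p ^ (m + l)) = 1.
Proof.
have [g [[g0 lg] keyg [A31 B31] CfB CgA]] := macd_p_relations.
have [u cpu Eu] := logn_split p_pr x0 lx.
have [v cpv Ev] := logn_split p_pr y0 ly.
have [d cpd Ed] := logn_split p_pr d0 lxy.
have [f1 cpf Ef] := logn_split p_pr f0 lf.
have [g1 cpg Eg] := logn_split p_pr g0 lg.
have pl : p ^ l %| x - y by rewrite Ed dvdn_mulr.
have [sA EA] := geo_modp p_pr p_odd px pl.
have [sB EB] := geo_modp p_pr p_odd py pl.
pose eA := (u * (d + p * sA))%N; pose eB := (v * (d + p * sB))%N.
have XA : (x * geo x.+1 (x - y) = p ^ (m + l) * eA)%N.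
  by rewrite EA {1}Eu {1}Ed expnS expnD /eA; ring.
have XB : (y * geo y.+1 (x - y) = p ^ (m + l) * eB)%N.
  by rewrite EB {1}Ev {1}Ed expnS expnD /eB; ring.
have cAfC : commute (A ^+ f) C.
  apply/commgP; rewrite -conjg_fix -[C]expg1 (macd_conjAX relAB) expn1 mulnS expgD.
  rewrite (_ : A ^+ (f * x) = 1) ?mulg1 // Ef Eu.
  rewrite (_ : _ * _ = p ^ (3 * m) * (f1 * u))%N; first by rewrite expgM A31 expg1n.
  by rewrite (_ : p ^ (3 * m) = p ^ (2 * m) * p ^ m)%N; [ring | rewrite -expnD addnC -mulSn].
have cAfB : commute (B ^+ g) (A ^+ f).
  have := commuteX (x - y) cAfC; rewrite keyg /commute mulgA => /mulIg.
  by move=> E; apply/esym.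
pose K := (p ^ (l - m) * (eA * eB))%N.
have gK : B ^+ (g * K) = C ^+ (f * g1 * eA).
  rewrite -[(_ * eA)%N]mulnA [RHS]expgM CfB -expgM XB; congr (B ^+ _).
  by rewrite Eg /K (_ : m + l = 2 * m + (l - m))%N ?expnD; [ring | lia].
have fK : A ^+ (f * K) = C ^+ (g * f1 * eB).
  rewrite -[(_ * eB)%N]mulnA [RHS]expgM CgA -expgM XA; congr (A ^+ _).
  by rewrite Ef /K (_ : m + l = 2 * m + (l - m))%N ?expnD; [ring | lia].
have : C ^+ (p ^ (2 * m) * (f1 * g1 * (eA + eB)))
     = C ^+ (p ^ (2 * m) * (p * (p ^ (2 * l - 3 * m - 1) * (d * eA * eB)))).
  have -> : C ^+ (p ^ (2 * m) * (f1 * g1 * (eA + eB))) = C ^+ ((x - y) * K).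
    rewrite [RHS]expgM keyg (expgMn K cAfB) -!expgM gK fK -expgD Ef Eg.
    by congr (C ^+ _); ring.
  rewrite Ed /K; congr (C ^+ _).
  have E : (p ^ l * p ^ (l - m) = p ^ (2 * m) * (p * p ^ (2 * l - 3 * m - 1)))%N.
    by rewrite -expnS -!expnD; congr (p ^ _)%N; lia.
  transitivity (p ^ l * p ^ (l - m) * (d * (eA * eB)))%N; first by ring.
  by rewrite E; ring.
have nzAB : ~~ (p %| f1 * g1 * (eA + eB))%N.
  rewrite !Euclid_dvdM // !negb_or -!prime_coprime // cpf cpg /=.
  (* As l > m, u and v agree modulo p, so eA + eB is 2 v d modulo p, a unit for odd p. *)
  have uv : u = (v + p ^ (l - m) * d)%N.
    apply/eqP; rewrite -(eqn_pmul2l (_ : 0 < p ^ m)) ?expn_gt0 ?p0 //.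
    rewrite -Eu mulnDr -Ev mulnA -expnD (_ : m + (l - m) = l)%N -?Ed ?subnKC //.
      exact: ltnW.
    exact: ltnW.
  have -> : (eA + eB = p * (p ^ (l - m - 1) * d * (d + p * sA) + v * (sA + sB)) + 2 * (v * d))%N.
    have E : (p ^ (l - m) = p * p ^ (l - m - 1))%N by rewrite -expnS; congr (p ^ _)%N; lia.
    by rewrite /eA /eB uv E; ring.
  rewrite prime_coprime // dvdn_addr; last by rewrite dvdn_mulr.
  rewrite !Euclid_dvdM // !negb_or.
  by rewrite odd_prime_ndvd2 // -!prime_coprime // cpv.
set D := C ^+ (p ^ (2 * m)); rewrite [LHS]expgM [RHS]expgM -/D => ED.
have D1 : D = 1.
  apply/eqP; rewrite -order_eq1; apply: contraR nzAB => D1.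
  have [e oD] := p_natP (pelt (groupX (p ^ (2 * m)) CG)); rewrite -/D in oD.
  have pD : p %| #[D].
    by rewrite oD in D1 *; case: (e) D1 => // e' _; rewrite expnS dvdn_mulr.
  have /eqP := ED; rewrite eq_expg_mod_order => /eqP E.
  have : p %| (p * (p ^ (2 * l - 3 * m - 1) * (d * eA * eB))) %% #[D].
    by rewrite /dvdn modn_dvdm // modnMr.
  by rewrite -E /dvdn modn_dvdm.
split=> //.
have XB0 : 0 < y * geo y.+1 (x - y).
  by rewrite muln_gt0 y0 geo_geo2 addn_gt0 d0.
apply: (p_elt_logn_expg p_pr (pelt BG) XB0).
  rewrite lognM ?logn_geo // ?lxy ?ly //; first by move: XB0; rewrite muln_gt0 => /andP[].
by rewrite -CfB Ef expgM -/D D1 expg1n.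
Qed.

Lemma macd_order_bound : #|G| <= p ^ (5 * m + l).
Proof.
have [g [[g0 lg] keyg _ _ _]] := macd_p_relations.
have [C1 B1] := macd_p_orders.
pose Y := (<[B]> <*> <[C]>)%G.
have nBC : <[C]> \subset 'N(<[B]>) by rewrite cycle_subG (macd_normB relAB).
have cardY : #|Y| <= p ^ (m + l) * p ^ (2 * m).
  rewrite /Y /= norm_joinEr //; apply: leq_trans (_ : #|<[B]>| * #|<[C]>| <= _)%N.
    by rewrite mul_cardG leq_pmulr // cardG_gt0.
  by apply: leq_mul; apply: dvdn_leq; rewrite ?expn_gt0 ?p0 // order_dvdn ?B1 ?C1.
have BY : B \in Y by rewrite mem_gen // inE cycle_id.
have CY : C \in Y by rewrite mem_gen // inE cycle_id orbT.
have A2 : A ^+ (p ^ (2 * m)) \in Y.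
  apply: root f0 lf _ => //; rewrite -(mulKg (B ^+ g) (A ^+ f)) -keyg.
  by rewrite groupM ?groupV ?groupX.
have cardA : #|<[A]>| <= #|<[A]> :&: Y| * p ^ (2 * m).
  apply: leq_trans (_ : #[A ^+ (p ^ (2 * m))] * p ^ (2 * m) <= _)%N.
    rewrite -orderE orderXgcd; set n := gcdn _ _.
    rewrite -{1}(divnK (dvdn_gcdl #[A] (p ^ (2 * m)))) leq_mul2l; apply/orP; right.
    by rewrite dvdn_leq ?expn_gt0 ?p0 // dvdn_gcdr.
  rewrite leq_mul2r; apply/orP; right; apply: subset_leq_card.
  by rewrite cycle_subG inE mem_cycle.
have := subset_leq_card (macd_prod defG relAB); rewrite -/C -/Y => cardG.
apply: leq_trans cardG _.
rewrite -(leq_pmul2r (cardG_gt0 (<[A]> :&: Y))) -mul_cardG.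
apply: leq_trans (leq_mul cardA cardY) _.
have -> : (5 * m + l = 2 * m + (m + l) + 2 * m)%N by ring.
by apply: eq_leq; rewrite !(expnD p); ring.
Qed.

End Bound.

(** * Integer powers and cyclic extensions *)

Section IntegerPowers.
Variable gT : finGroupType.
Implicit Types (g h : gT) (i j : int).

Lemma zexpg_modz g i : zexpg g i = g ^+ absz (i %% #[g])%Z.
Proof.
have og : (#[g] : int) != 0 by rewrite eqz_nat -lt0n order_gt0.
case: i => n; first by rewrite /= modz_nat absz_nat expg_mod_order.
apply: (mulIg (g ^+ n.+1)); rewrite /= mulVg -expgD.
apply/esym/eqP; rewrite -order_dvdn; set a := absz _.
rewrite -[(_ %| _)%N]/((#[g] : int) %| ((a + n.+1)%N : int))%Z PoszD gez0_abs ?modz_ge0 //.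
by apply/dvdz_mod0P; rewrite modzDml NegzE addNr mod0z.
Qed.

Lemma zexpg_nat g (n : nat) : zexpg g n = g ^+ n. Proof. by []. Qed.

Lemma zexpgD g i j : zexpg g (i + j)%R = zexpg g i * zexpg g j.
Proof.
have og : (#[g] : int) != 0 by rewrite eqz_nat -lt0n order_gt0.
rewrite !zexpg_modz -expgD -[RHS]expg_mod_order; congr (_ ^+ _).
apply/eqP; rewrite -eqz_nat -modz_nat PoszD !gez0_abs ?modz_ge0 //.
by rewrite modzDm.
Qed.

Lemma zexpgN g i : zexpg g (- i)%R = (zexpg g i)^-1.
Proof. by apply: (mulIg (zexpg g i)); rewrite -zexpgD addNr mulVg. Qed.

Lemma zexpgM g i j : zexpg g (i * j)%R = zexpg (zexpg g i) j.
Proof.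
have E (n : nat) : zexpg g (i * n)%R = zexpg g i ^+ n.
  elim: n => [|n IH]; first by rewrite mulr0.
  by rewrite intS mulrDr mulr1 zexpgD IH expgS.
by case: j => n; [rewrite E | rewrite NegzE mulrN !zexpgN E].
Qed.

Lemma zexpg_mulgC g i h : commute g h -> commute (zexpg g i) h.
Proof.
by move=> c; rewrite zexpg_modz; apply/commute_sym/commuteX/commute_sym.
Qed.

Lemma zexpg_eq1 g i : (zexpg g i == 1) = (#[g] %| i)%Z.
Proof.
rewrite zexpg_modz -order_dvdn; have og : (#[g] : int) != 0 by rewrite eqz_nat -lt0n order_gt0.
rewrite -[LHS]/((#[g] : int) %| (i %% #[g])%Z)%Z.
by apply/dvdz_mod0P/dvdz_mod0P; rewrite modz_mod.
Qed.

End IntegerPowers.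

(** The last three fields are the classical conditions for a cyclic extension; bundling them with
    the data lets the group structure be attached to [cycext D]. The degree is at least 2, so that
    index 1 differs from index 0 and the generator lies outside the base. *)
Record cycext_data := CycextData {
  ce_base : finGroupType;
  ce_aut : ce_base -> ce_base;
  ce_pow : ce_base;
  ce_deg : nat;
  ce_autM : {morph ce_aut : g h / g * h};
  ce_aut_pow : ce_aut ce_pow = ce_pow;
  ce_iter : forall g, iter ce_deg.+2 ce_aut g = g ^ ce_pow }.

(* The pair (i, g) stands for t^i g, where g t = t (ce_aut g) and t^(ce_deg.+2) = ce_pow. *)
Definition cycext (D : cycext_data) : Type := ('I_(ce_deg D).+2 * ce_base D)%type.
HB.instance Definition _ (D : cycext_data) := Finite.on (cycext D).

Section CyclicExtension.
Variable D : cycext_data.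
Local Notation k := (ce_deg D).+2.
Local Notation f := (@ce_aut D).
Local Notation z := (ce_pow D).

Let fn j : {morph iter j f : g h / g * h}.
Proof. elim: j => [//|j IH] g h. by rewrite !iterS IH ce_autM. Qed.

Let fz j e : iter j f (z ^+ e) = z ^+ e.
Proof.
elim: j => // j IHj; rewrite iterS {}IHj.
elim: e => [|e IH]; last by rewrite !expgS ce_autM IH ce_aut_pow.
by apply: (mulgI (f 1)); rewrite -ce_autM !mulg1.
Qed.

Let f1 : f 1 = 1. Proof. exact: (fz 1 0). Qed.

(** Reducing the exponent of t modulo k replaces t^k by z, while the k-th iterate of f is
    conjugation by z. This cocycle identity gives associativity. *)
Let f_mod j g : iter (j %% k) f g * z ^+ (j %/ k) = z ^+ (j %/ k) * iter j f g.
Proof.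
have iterk c : iter (c * k) f g = g ^ (z ^+ c).
  elim: c => [|c IH]; first by rewrite conjg1.
  by rewrite mulSn iterD IH ce_iter expgSr conjgM.
have -> : iter j f g = iter (j %% k) f (g ^ (z ^+ (j %/ k))).
  by rewrite -iterk -iterD addnC -divn_eq.
by rewrite -{2}(fz (j %% k) (j %/ k)) -fn -conjgC fn fz.
Qed.

Definition cycext_mul (s t : cycext D) : cycext D :=
  (inZp (s.1 + t.1), z ^+ ((s.1 + t.1) %/ k) * iter t.1 f s.2 * t.2).
Definition cycext_one : cycext D := (ord0, 1).
(** Multiplying by s brings the number of applications of f to k, that is to conjugation by z, which
    the conjugation by z^-1 cancels. *)
Definition cycext_inv (s : cycext D) : cycext D :=
  let j := (k - s.1)%N in
  (inZp j, iter j f ((z ^- ((j %% k + s.1) %/ k) * s.2^-1) ^ z^-1)).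

Let cycext_mulA : associative cycext_mul.
Proof.
move=> [i g] [j h] [r w]; congr pair => /=.
  by apply: val_inj; rewrite /= modnDml modnDmr addnA.
rewrite !fn fz !mulgA.
have mod_div a b : ((a %% k + b) %/ k + a %/ k = (a + b) %/ k)%N.
  by rewrite {3}(divn_eq a k) -addnA divnMDl // addnC.
congr (_ * _); congr (_ * _); rewrite -[LHS]mulgA f_mod mulgA -!expgD -iterD [(r + j)%N]addnC.
by rewrite mod_div [(i + _ %% k)%N]addnC mod_div addnC addnA.
Qed.

Let cycext_mul1 : left_id cycext_one cycext_mul.
Proof.
move=> [i g]; congr pair => /=; first by apply: val_inj; rewrite /= add0n modn_small.
by rewrite add0n divn_small // mul1g (fz i 0) mul1g.
Qed.

Let cycext_mulV : left_inverse cycext_one cycext_inv cycext_mul.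
Proof.
move=> [i g]; have ik := ltn_ord i; congr pair => /=.
  by apply: val_inj; rewrite /= modnDml subnK ?modnn // ltnW.
by rewrite -iterD subnKC ?(ltnW ik) // ce_iter conjgKV mulgA mulgV mul1g mulVg.
Qed.

HB.instance Definition _ :=
  Finite_isGroup.Build (cycext D) cycext_mulA cycext_mul1 cycext_mulV.

Definition cycext_in (g : ce_base D) : cycext D := (ord0, g).
Definition cycext_gen : cycext D := (inZp 1, 1).

Lemma cycext_inM : {morph cycext_in : g h / g * h}.
Proof. by move=> g h; congr pair; [apply: val_inj | rewrite /= mul1g]. Qed.

Lemma cycext_genX j : j < k -> cycext_gen ^+ j = (inZp j, 1).
Proof.
elim: j => [|j IH] jk; first by congr pair; apply: val_inj.
rewrite expgSr IH; last exact: ltnW.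
congr pair => /=; first by apply: val_inj; rewrite /= modnDml modnDmr addn1.
by rewrite (modn_small (ltnW jk)) modn_small // addn1 divn_small // f1 !mulg1.
Qed.

Lemma cycext_genX1 j : (cycext_gen ^+ j).1 = inZp j.
Proof.
elim: j => [|j IH]; first exact: val_inj.
by rewrite expgSr; apply: val_inj; rewrite /= IH /= modnDml modnDmr addn1.
Qed.

Lemma cycextE (s : cycext D) : s = cycext_gen ^+ s.1 * cycext_in s.2.
Proof.
case: s => i g; rewrite cycext_genX //; congr pair => /=.
  by apply: val_inj; rewrite /= addn0 modn_mod modn_small.
by rewrite addn0 modn_small // divn_small // !mul1g.
Qed.

Lemma cycext_genK : cycext_gen ^+ k = cycext_in z.
Proof.
rewrite expgSr cycext_genX //; congr pair => /=.
  by apply: val_inj; rewrite /= modnDml modnDmr addn1 modnn.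
by rewrite !modn_small // addn1 divnn expg1 f1 !mulg1.
Qed.

Lemma cycext_inJ g : cycext_in g ^ cycext_gen = cycext_in (f g).
Proof.
apply: (mulgI cycext_gen); rewrite -conjgC; congr pair => /=.
by rewrite add0n addn0 !modn_small // !divn_small // /= !mul1g mulg1.
Qed.

Lemma cycext_extend (rT : finGroupType) (u : ce_base D -> rT) (s : rT) :
    {morph u : g h / g * h} -> (forall g, u g ^ s = u (f g)) -> s ^+ k = u z ->
  exists v : cycext D -> rT,
    [/\ {morph v : g h / g * h}, forall g, v (cycext_in g) = u g & v cycext_gen = s].
Proof.
move=> uM uJ sk; have u1 : u 1 = 1 by apply: (mulgI (u 1)); rewrite -uM !mulg1.
have uJn j g : u g ^ (s ^+ j) = u (iter j f g).
  by elim: j => [|j IH]; rewrite ?conjg1 // expgSr conjgM IH uJ.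
have uX e g : u (g ^+ e) = u g ^+ e by elim: e => [//|e IH]; rewrite !expgS uM IH.
exists (fun w : cycext D => s ^+ w.1 * u w.2); split=> [[i g] [j h]|g|] /=; last 2 first.
- by rewrite mul1g.
- by rewrite u1 mulg1 modn_small.
rewrite !uM uX -sk -uJn -!expgM !mulgA -expgD [(k * _)%N]mulnC addnC -divn_eq.
by rewrite expgD mulgK.
Qed.

End CyclicExtension.

(** The last clause is the universal property: a homomorphism from [hT] is given by its restriction
    to the base and the image of t. It produces the twisting map of the next extension. *)
Definition cyclic_ext (gT hT : finGroupType) (f : gT -> gT) (z : gT) (k : nat)
    (i : {morphism [set: gT] >-> hT}) (t : hT) : Prop :=
  [/\ [/\ 'injm i, forall g, i g ^ t = i (f g), t ^+ k = i z & #|hT| = (k * #|gT|)%N],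
      forall j g, t ^+ j = i g -> k %| j,
      forall s, exists j g, s = t ^+ j * i g &
      forall (rT : finGroupType) (u : gT -> rT) (s : rT),
        {morph u : g h / g * h} -> (forall g, u g ^ s = u (f g)) -> s ^+ k = u z ->
        exists v : hT -> rT,
          [/\ {morph v : g h / g * h}, forall g, v (i g) = u g & v t = s]].

Lemma cyclic_ext_exists (gT : finGroupType) (f : gT -> gT) (z : gT) (k : nat) :
    {morph f : g h / g * h} -> f z = z -> 1 < k ->
    (forall g, iter k f g = g ^ z) ->
  exists (hT : finGroupType) (i : {morphism [set: gT] >-> hT}) (t : hT),
    cyclic_ext f z k i t.
Proof.
case: k => [|[|k]] // fM fz _ fk; pose D := CycextData fM fz fk.
have iM : {in [set: gT] &, {morph @cycext_in D : g h / g * h}}.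
  by move=> g h _ _; apply: cycext_inM.
exists (cycext D), (Morphism iM), (cycext_gen D); split; first split.
- by apply/injmP=> g h _ _ [].
- exact: (@cycext_inJ D).
- exact: cycext_genK.
- by rewrite card_prod card_ord.
- move=> j g /(congr1 (fun s : cycext D => val s.1)) /eqP.
  by rewrite cycext_genX1.
- by move=> s; exists s.1, s.2; apply: cycextE.
- by move=> rT u s; apply: (@cycext_extend D).
Qed.

(** * The model *)

(* Used to prove identities by ring modulo hypotheses that make e vanish. *)
Lemma eq_of_sub0 (R : zmodType) (a b e : R) : (a - b = e -> e = 0 -> a = b)%R.
Proof. by move=> E e0; apply/eqP; rewrite -subr_eq0 E e0. Qed.

(* The relations between a, b, c in the abelian group V of the model: the lattice
   generated by L a, L b, N c and N h (u^2 a + v^2 b) - D c.  There N = p^m, L = p^l,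
   x = N u, y = N v, D = u - v and h = (N + 1) / 2 stands for 1/2; the last generator
   is the key relation C^(x - y) = B^g A^f written additively. *)
Definition lattice3 (L N h u v D i j k : int) : Prop :=
  exists q1 q2 q3 t : int,
    [/\ i = L * q1 + N * h * u * u * t, j = L * q2 + N * h * v * v * t
      & k = N * q3 - D * t]%R.

Lemma Zp_intr_eq0 (n : nat) (i : int) : 1 < n ->
  ((i%:~R == 0 :> 'Z_n)%R = (n %| i)%Z).
Proof.
move=> n1; have E (k : nat) : ((k%:R == 0 :> 'Z_n)%R = (n %| k)%N).
  by rewrite -val_eqE /= val_Zp_nat.
case: i => k; first by rewrite -pmulrn E.
by rewrite {1}NegzE mulrNz oppr_eq0 -pmulrn E.
Qed.

(* V is obtained from <a> x <c> by adjoining an N-th root of ra a + rc c as b. *)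
Lemma abelian_base (L N : nat) (h u v w D Q d f E w' : int) :
    1 < L -> 1 < N ->
    (N%:Z * N%:Z = L%:Z * E -> L%:Z = N%:Z * Q -> D = Q * d -> Q * Q = N%:Z * f ->
     v * v * w = 1 + L%:Z * w' -> h * 2%:Z = 1 + N%:Z ->
     (forall c, (Q %| u * u * w * c)%Z -> (Q %| c)%Z) ->
  exists (V : finGroupType) (phi : int -> int -> int -> V),
    [/\ forall i j k i' j' k', phi (i + i') (j + j') (k + k') = (phi i j k * phi i' j' k')%g,
        forall s, exists i j k, s = phi i j k,
        #|V| = (N * (L * N))%N,
        forall i j k, phi i j k = 1%g <-> lattice3 L N h u v D i j k &
        [/\ forall i, phi i 0 0 = 1%g -> (L %| i)%Z,
            forall j, phi 0 j 0 = 1%g -> (L %| j)%Z &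
            forall k, phi 0 0 k = 1%g -> (N %| k)%Z]])%R.
Proof.
move=> L1 N1 EN EL ED EQ Ew Eh cop.
have zN := etrans (congr1 (fun a => a - L%:Z * E)%R EN) (subrr _).
have zL := etrans (congr1 (fun a => a - N%:Z * Q)%R EL) (subrr _).
have zD := etrans (congr1 (fun a => a - Q * d)%R ED) (subrr _).
have zQ := etrans (congr1 (fun a => a - N%:Z * f)%R EQ) (subrr _).
have zw := etrans (congr1 (fun a => a - (1 + L%:Z * w'))%R Ew) (subrr _).
have zh := etrans (congr1 (fun a => a - (1 + N%:Z))%R Eh) (subrr _).
rewrite /= in zN zL zD zQ zw zh.
pose W : finGroupType := ('Z_L * 'Z_N)%type.
pose psi (i k : int) : W := (i%:~R, k%:~R)%R.
have psiD i i' k k' : psi (i + i')%R (k + k')%R = psi i k * psi i' k'.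
  by rewrite /psi !intrD.
have psi1 i k : psi i k = 1 <-> (L %| i)%Z /\ (N %| k)%Z.
  split=> [[/eqP iL /eqP kN]|[iL kN]]; first by rewrite -!Zp_intr_eq0 //.
  by congr pair; apply/eqP; rewrite Zp_intr_eq0.
have psi_surj s : exists i k, s = psi i k.
  case: s => a b; exists (a : nat), (b : nat).
  by congr pair; rewrite -pmulrn natr_Zp.
(* The key relation solved for N b: multiply it by 2 w, where w inverts v^2 modulo L and 2 h N is N
   modulo L. *)
pose ra : int := (- N%:Z * u * u * w)%R; pose rc : int := (2 * w * D)%R.
have idM : {morph @id W : g g' / g * g'} by [].
have cW (g g' : W) : g * g' = g' * g by congr pair; apply: addrC.
have itid g : iter N (@id W) g = g ^ psi ra rc.
  by rewrite conjgE [g * _]cW mulKg; elim: (N).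
have [V [inV [t [[inV_inj inVJ tN cardV] tdiv surjV _]]]] :=
  cyclic_ext_exists idM erefl N1 itid.
have comm g : commute t (inV g).
  by apply/commgP; rewrite commg1_sym -conjg_fix inVJ.
pose phi (i j k : int) := zexpg t j * inV (psi i k).
exists V, phi; rewrite /phi.
have tN' c : zexpg t (N%:Z * c)%R = inV (psi (ra * c) (rc * c))%R.
  have P (n : nat) : inV (psi ra rc) ^+ n = inV (psi (ra * n) (rc * n))%R.
    elim: n => [|n IH]; first by rewrite !mulr0 -[psi 0 0]/(1 : W) morph1.
    by rewrite expgS IH intS !mulrDr !mulr1 psiD morphM ?inE.
  rewrite zexpgM zexpg_nat tN; case: c => n; first exact: P.
  rewrite NegzE zexpgN zexpg_nat P; apply: (mulgI (inV (psi (ra * n.+1) (rc * n.+1))%R)).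
  by rewrite mulgV -morphM ?inE // -psiD !mulrN !addrN -[psi 0 0]/(1 : W) morph1.
have ker i j k : phi i j k = 1 <->
    exists c, [/\ j = (N%:Z * c)%R, (L %| (i + ra * c)%R)%Z & (N %| (k + rc * c)%R)%Z].
  split=> [E1|[c [-> iL kN]]]; last first.
    rewrite /phi tN' -morphM ?inE // -psiD.
    by rewrite (_ : psi _ _ = 1) ?morph1 // psi1 ![(_ * c + _)%R]addrC.
  have /dvdzP[c Ec] : (N %| j)%Z.
    have Ej : zexpg t j = inV (psi i k)^-1.
      by apply: (mulIg (inV (psi i k))); rewrite -morphM ?inE // mulVg morph1.
    case: (j) Ej => n; first exact: tdiv.
    rewrite NegzE zexpgN => /(canRL invgK); rewrite -morphV ?inE //; exact: tdiv.
  rewrite mulrC in Ec; exists c; move: E1; rewrite /phi Ec tN' -morphM ?inE // -psiD.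
  move/eqP; rewrite morph_injm_eq1 ?inE // => /eqP/psi1[].
  by rewrite ![(_ * c + _)%R]addrC.
split.
- move=> i j k i' j' k'; rewrite zexpgD psiD morphM ?inE // -!mulgA; congr (_ * _).
  rewrite !mulgA; congr (_ * _); rewrite zexpg_mulgC //; exact: comm.
- move=> s; have [j [g ->]] := surjV s; have [i [k ->]] := psi_surj g.
  by exists i, (j : int), k.
- by rewrite cardV card_prod !card_ord !Zp_cast.
- move=> i j k; rewrite ker; split.
    case=> c [-> /dvdzP[q1 E1] /dvdzP[q3 E3]].
    exists (q1 - E * u * u * w * c)%R, (- c * (E + N%:Z * w' + N%:Z * N%:Z * w'))%R, q3, (2 * w * c)%R.
    split.
    + apply: (@eq_of_sub0 _ _ _ ((i + ra * c - q1 * L%:Z)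
        - (u * u * w * c) * (N%:Z * N%:Z - L%:Z * E) - N%:Z * u * u * w * c * (h * 2%:Z - (1 + N%:Z))))%R.
        by rewrite /ra; ring.
      by rewrite E1 subrr zN zh; ring.
    + apply: (@eq_of_sub0 _ _ _ ((- c) * (N%:Z * N%:Z - L%:Z * E)
          - N%:Z * v * v * w * c * (h * 2%:Z - (1 + N%:Z))
          - N%:Z * c * (1 + N%:Z) * (v * v * w - (1 + L%:Z * w'))))%R.
        by ring.
      by rewrite zN zw zh; ring.
    + apply: (@eq_of_sub0 _ _ _ (k + rc * c - q3 * N%:Z))%R; last by rewrite E3 subrr.
      by rewrite /rc; ring.
  case=> q1 [q2 [q3 [s [-> -> ->]]]].
  exists (Q * q2 + h * v * v * s)%R; split.
  + apply: (@eq_of_sub0 _ _ _ (q2 * (L%:Z - N%:Z * Q)))%R; last by rewrite zL mulr0.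
    by ring.
  + apply/dvdzP; exists (q1 - u * u * w * q2 - N%:Z * h * u * u * s * w')%R.
    apply: (@eq_of_sub0 _ _ _ (u * u * w * q2 * (L%:Z - N%:Z * Q)
       - N%:Z * h * u * u * s * (v * v * w - (1 + L%:Z * w'))))%R.
      by rewrite /ra; ring.
    by rewrite zw zL; ring.
  (* L b = 0 requires N to divide rc Q = 2 w d Q^2, which holds since Q^2 = N f. *)
  + apply/dvdzP; exists (q3 + 2 * w * d * f * q2 + (1 + Q * w' + N%:Z * Q * w') * D * s)%R.
    apply: (@eq_of_sub0 _ _ _ (2 * w * Q * q2 * (D - Q * d) + 2 * w * d * q2 * (Q * Q - N%:Z * f)
       + D * s * (v * v * w) * (h * 2%:Z - (1 + N%:Z))
       + D * s * (1 + N%:Z) * (v * v * w - (1 + L%:Z * w'))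
       + D * s * w' * (1 + N%:Z) * (L%:Z - N%:Z * Q)))%R.
      by rewrite /rc; ring.
    by rewrite zL zD zQ zw zh; ring.
- have N0 : (N%:Z != 0)%R by rewrite eqz_nat -lt0n ltnW.
  have c0 c : (0 = N%:Z * c)%R -> c = 0%R.
    by move/esym/eqP; rewrite mulf_eq0 (negPf N0) => /eqP.
  split=> [i /ker[c [/c0 ->]]|j /ker[c [-> Lc _]]|k /ker[c [/c0 ->]]].
  + by rewrite mulr0 addr0.
  (* Here j = N c with L dividing ra c, that is, Q dividing u^2 w c; so Q divides c and L = N Q
     divides j. *)
  + rewrite EL dvdz_mul2l //; apply: cop; move: Lc.
    by rewrite add0r EL /ra !mulNr dvdzE abszN -dvdzE -!mulrA dvdz_mul2l.
  + by rewrite !(mulr0, addr0) => _.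
Qed.

Lemma morph_fun1 (gT hT : finGroupType) (f : gT -> hT) :
  {morph f : g h / g * h} -> f 1 = 1.
Proof. by move=> fM; apply: (mulgI (f 1)); rewrite -fM !mulg1. Qed.

Lemma iter_morph (gT : finGroupType) (f : gT -> gT) r :
  {morph f : g h / g * h} -> {morph iter r f : g h / g * h}.
Proof. by move=> fM; elim: r => [//|r IH] g h; rewrite !iterS IH fM. Qed.

Lemma morphX_fun (gT hT : finGroupType) (f : gT -> hT) :
  {morph f : g h / g * h} -> forall g n, f (g ^+ n) = f g ^+ n.
Proof.
move=> fM g; elim=> [|n IH]; first exact: morph_fun1.
by rewrite !expgS fM IH.
Qed.

(* wsum b r is the sum of k b^k for k < r. *)
Fixpoint wsum (b r : nat) : nat :=
  if r is r'.+1 then b * (wsum b r' + geo b r') else 0.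

Lemma wsum_bin b r : exists g,
  wsum b.+1 r = 'C(r, 2) + b * (2 * 'C(r, 3) + 'C(r, 2)) + b * b * g.
Proof.
elim: r => [|r [g IH]]; first by exists 0; rewrite !bin_small //=; ring.
exists (g + geo3 b.+1 r + (2 * 'C(r, 3) + 'C(r, 2) + 'C(r, 2)) + b * (g + geo3 b.+1 r)).
by rewrite /= IH geo_geo2 geo2_geo3 !binS bin1; ring.
Qed.

(* P i j k stands for A^(N i) B^(N j) C^(N k). *)
Record macd_model (L N u v : nat) (h D : int) (T : finGroupType) (A B : T)
    (P : int -> int -> int -> T) : Prop := MacdModel {
  modelD : forall i j k i' j' k',
    P (i + i')%R (j + j')%R (k + k')%R = P i j k * P i' j' k';
  model_ker : forall i j k, P i j k = 1 <-> lattice3 L N h u v D i j k;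
  model_rel : macd (N * u)%N (N * v)%N A B;
  modelA : A ^+ N = P 1%R 0%R 0%R;
  modelB : B ^+ N = P 0%R 1%R 0%R;
  modelC : [~ A, B] ^+ N = P 0%R 0%R 1%R;
  modelPA : forall i j k, P i j k ^ A =
    P (i - (N * u)%N%:Z * k)%R (j * (1 + h * (N * v)%N%:Z))%R (k - j)%R;
  modelPB : forall i j k, P i j k ^ B =
    P (i * (1 + h * (N * u)%N%:Z))%R (j + (N * v)%N%:Z * k)%R (k + i)%R;
  modelCA : [~ A, B] ^ A = [~ A, B] * P (- u%:Z)%R 0%R 0%R;
  modelCB : [~ A, B] ^ B = P 0%R (v%:Z)%R 0%R * [~ A, B];
  model_gen : [set: T] = <<[set A; B]>>
}.

(* V is written additively through phi; UC, UA, UB are the actions on V of C, A, B,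
   and T1 = V<C>, T2 = V<C, A>, T3 = V<C, A, B>. *)
Section Tower.
Variables (L N u v : nat) (h D Q E d c3 : int).
Hypothesis N1 : 1 < N.
Hypotheses (EN : (N%:Z = Q * E)%R) (EL : (L%:Z = Q * E * Q)%R).
Hypotheses (ED : (D = Q * d)%R) (Eu : (u%:Z = v%:Z + Q * d)%R).
Hypotheses (Eh : (h * 2 = 1 + Q * E)%R) (Ec3 : (N%:Z * 'C(N, 3)%:Z = Q * E * Q * c3)%R).
Let x := (N * u)%N.
Let y := (N * v)%N.

Let Ex : (x%:Z = Q * E * u%:Z)%R. Proof. by rewrite /x PoszM EN. Qed.
Let Ey : (y%:Z = Q * E * v%:Z)%R. Proof. by rewrite /y PoszM EN. Qed.

Variables (V : finGroupType) (phi : int -> int -> int -> V).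
Hypothesis phiD : forall i j k i' j' k',
  phi (i + i')%R (j + j')%R (k + k')%R = phi i j k * phi i' j' k'.
Hypothesis phi_surj : forall s, exists i j k, s = phi i j k.
Hypothesis phi_ker : forall i j k, phi i j k = 1 <-> lattice3 L N h u v D i j k.

Lemma phi0 : phi 0 0 0 = 1.
Proof. by apply: (mulgI (phi 0 0 0)); rewrite -phiD !addr0 mulg1. Qed.

Lemma phi_comm : forall s t : V, s * t = t * s.
Proof.
move=> s t; have [i [j [k ->]]] := phi_surj s; have [i' [j' [k' ->]]] := phi_surj t.
by rewrite -!phiD [(i + _)%R]addrC [(j + _)%R]addrC [(k + _)%R]addrC.
Qed.

Lemma phiN i j k : phi (- i)%R (- j)%R (- k)%R = (phi i j k)^-1.
Proof. by apply: (mulgI (phi i j k)); rewrite -phiD !addrN mulgV phi0. Qed.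

Lemma phi_eq i j k i' j' k' :
  lattice3 L N h u v D (i - i')%R (j - j')%R (k - k')%R -> phi i j k = phi i' j' k'.
Proof.
move/phi_ker; rewrite phiD phiN => E1.
by apply: (mulIg (phi i' j' k')^-1); rewrite E1 mulgV.
Qed.

(** V is known only as a quotient of Z^3, so its endomorphisms come from additive maps that preserve
    the lattice; U evaluates such a map at chosen coordinates. *)
Lemma phi_endo (F1 F2 F3 : int -> int -> int -> int) :
    (forall i j k i' j' k', F1 (i + i')%R (j + j')%R (k + k')%R = (F1 i j k + F1 i' j' k')%R) ->
    (forall i j k i' j' k', F2 (i + i')%R (j + j')%R (k + k')%R = (F2 i j k + F2 i' j' k')%R) ->
    (forall i j k i' j' k', F3 (i + i')%R (j + j')%R (k + k')%R = (F3 i j k + F3 i' j' k')%R) ->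
    (forall i j k, lattice3 L N h u v D i j k ->
       lattice3 L N h u v D (F1 i j k) (F2 i j k) (F3 i j k)) ->
  exists U : V -> V, {morph U : s t / s * t} /\
    forall i j k, U (phi i j k) = phi (F1 i j k) (F2 i j k) (F3 i j k).
Proof.
move=> F1D F2D F3D FL.
have surj s : exists w : int * int * int, phi w.1.1 w.1.2 w.2 == s.
  by have [i [j [k ->]]] := phi_surj s; exists (i, j, k).
pose F (w : int * int * int) :=
  phi (F1 w.1.1 w.1.2 w.2) (F2 w.1.1 w.1.2 w.2) (F3 w.1.1 w.1.2 w.2).
pose U s := F (xchoose (surj s)).
have UE i j k : U (phi i j k) = phi (F1 i j k) (F2 i j k) (F3 i j k).
  rewrite /U /F; have /eqP := xchooseP (surj (phi i j k)).
  move: (xchoose _) => [[i' j'] k'] /= E1.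
  have /phi_ker/FL/phi_ker : phi (i - i')%R (j - j')%R (k - k')%R = 1.
    by rewrite phiD phiN E1 mulgV.
  move=> E2; rewrite -[in RHS](subrK i' i) -[in RHS](subrK j' j) -[in RHS](subrK k' k).
  by rewrite F1D F2D F3D phiD E2 mul1g.
exists U; split=> // s t.
have [i [j [k ->]]] := phi_surj s; have [i' [j' [k' ->]]] := phi_surj t.
by rewrite -phiD !UE F1D F2D F3D phiD.
Qed.

(** Coordinates along a and b count modulo L, and L divides N^2, hence y^2; so 1 - y serves as the
    inverse of 1 + y. *)
Lemma endoC : exists U : V -> V, {morph U : s t / s * t} /\
  forall i j k, U (phi i j k) = phi (i * (1 + x%:Z))%R (j * (1 - y%:Z))%R k.
Proof.
apply: (@phi_endo (fun i _ _ => i * (1 + x%:Z)) (fun _ j _ => j * (1 - y%:Z)) (fun _ _ k => k))%R;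
  try by move=> *; ring.
move=> i j k [q1 [q2 [q3 [t [-> -> ->]]]]].
exists (q1 * (1 + x%:Z) + E * h * u%:Z * u%:Z * u%:Z * t)%R,
       (q2 * (1 - y%:Z) - E * h * v%:Z * v%:Z * v%:Z * t)%R, q3, t.
by split; rewrite ?Ex ?Ey ?EN ?EL ?ED; ring.
Qed.

(** The factor 1 + h y is the exponent of B in [macd_conjBXA] for n = N, divided by N and taken
    modulo L: y + y (N-1)/2 = h y. The term in x k comes from [macd_conjCXA] in the same way. *)
Lemma endoA : exists U : V -> V, {morph U : s t / s * t} /\
  forall i j k, U (phi i j k) = phi (i - x%:Z * k)%R (j * (1 + h * y%:Z))%R (k - j)%R.
Proof.
apply: (@phi_endo (fun i _ k => i - x%:Z * k) (fun _ j _ => j * (1 + h * y%:Z)) (fun _ j k => k - j))%R;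
  try by move=> *; ring.
move=> i j k [q1 [q2 [q3 [t [-> -> ->]]]]].
exists (q1 - E * u%:Z * q3 + u%:Z * d * t)%R,
       (q2 * (1 + h * y%:Z) + E * h * h * v%:Z * v%:Z * v%:Z * t)%R,
       (q3 - Q * q2 - h * v%:Z * v%:Z * t)%R, t.
by split; rewrite ?Ex ?Ey ?EN ?EL ?ED; ring.
Qed.

Lemma endoB : exists U : V -> V, {morph U : s t / s * t} /\
  forall i j k, U (phi i j k) = phi (i * (1 + h * x%:Z))%R (j + y%:Z * k)%R (k + i)%R.
Proof.
apply: (@phi_endo (fun i _ _ => i * (1 + h * x%:Z)) (fun _ j k => j + y%:Z * k) (fun i _ k => k + i))%R;
  try by move=> *; ring.
move=> i j k [q1 [q2 [q3 [t [-> -> ->]]]]].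
exists (q1 * (1 + h * x%:Z) + E * h * h * u%:Z * u%:Z * u%:Z * t)%R,
       (q2 + E * v%:Z * q3 - v%:Z * d * t)%R,
       (q3 + Q * q1 + h * u%:Z * u%:Z * t)%R, t.
by split; rewrite ?Ex ?Ey ?EN ?EL ?ED; ring.
Qed.

Lemma bin2_half : ('C(N, 2)%:Z = Q * E * (h - 1))%R.
Proof.
have : ((2 * 'C(N, 2))%N%:Z = (N * N.-1)%N%:Z)%R.
  by rewrite -[2]/(1.+1) -mul_bin_diag bin1.
have -> : ((N * N.-1)%N%:Z = N%:Z * (N%:Z - 1))%R by case: (N) N1 => // n _; rewrite PoszM -[1%R]/(1%N%:Z)%R subzn // subn1.
rewrite PoszM EN => E2; apply: (mulfI (_ : (2 : int) != 0)%R) => //.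
rewrite [LHS]E2; have -> : (Q * E = h * 2 - 1)%R by rewrite Eh; ring.
by ring.
Qed.

Variables UC UA UB : V -> V.
Hypotheses (UCM : {morph UC : s t / s * t}) (UAM : {morph UA : s t / s * t})
  (UBM : {morph UB : s t / s * t}).
Hypothesis UCE : forall i j k,
  UC (phi i j k) = phi (i * (1 + x%:Z))%R (j * (1 - y%:Z))%R k.
Hypothesis UAE : forall i j k,
  UA (phi i j k) = phi (i - x%:Z * k)%R (j * (1 + h * y%:Z))%R (k - j)%R.
Hypothesis UBE : forall i j k,
  UB (phi i j k) = phi (i * (1 + h * x%:Z))%R (j + y%:Z * k)%R (k + i)%R.

Lemma iterC r i j k :
  iter r UC (phi i j k) = phi (i * (1 + r%:Z * x%:Z))%R (j * (1 - r%:Z * y%:Z))%R k.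
Proof.
elim: r => [|r IH]; first by congr phi; ring.
rewrite iterS IH UCE; apply: phi_eq.
exists (i * r%:Z * E * u%:Z * u%:Z)%R, (j * r%:Z * E * v%:Z * v%:Z)%R, 0%R, 0%R.
by rewrite intS Ex Ey EL; split; ring.
Qed.

(** C^N is to be [phi 0 0 1], an element of the abelian group V, so it has to act trivially on V;
    the same is required of A^N and B^N. *)
Lemma iterCN s : iter N UC s = s.
Proof.
have [i [j [k ->]]] := phi_surj s; rewrite iterC; apply: phi_eq.
exists (i * E * u%:Z)%R, (- j * E * v%:Z)%R, 0%R, 0%R.
by rewrite Ex Ey EL EN; split; ring.
Qed.

Lemma iterA r i j k : iter r UA (phi i j k) =
  phi (i - x%:Z * (r%:Z * k - 'C(r, 2)%:Z * j))%R (j * (1 + r%:Z * h * y%:Z))%R (k - r%:Z * j)%R.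
Proof.
elim: r => [|r IH].
  by rewrite bin_small //; congr phi; ring.
rewrite iterS IH UAE; apply: phi_eq.
exists 0%R, (j * r%:Z * h * h * E * v%:Z * v%:Z)%R, (- j * r%:Z * h * v%:Z)%R, 0%R.
by rewrite binS bin1 PoszD intS Ex Ey EL EN; split; ring.
Qed.

Lemma iterAN s : iter N UA s = s.
Proof.
have [i [j [k ->]]] := phi_surj s; rewrite iterA; apply: phi_eq.
exists (- E * u%:Z * k + E * u%:Z * (h - 1) * j)%R, (j * h * E * v%:Z)%R, (- j)%R, 0%R.
by rewrite bin2_half Ex Ey EL EN; split; ring.
Qed.

Lemma iterB r i j k : iter r UB (phi i j k) =
  phi (i * (1 + r%:Z * h * x%:Z))%R (j + y%:Z * (r%:Z * k + 'C(r, 2)%:Z * i))%R (k + r%:Z * i)%R.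
Proof.
elim: r => [|r IH].
  by rewrite bin_small //; congr phi; ring.
rewrite iterS IH UBE; apply: phi_eq.
exists (i * r%:Z * h * h * E * u%:Z * u%:Z)%R, 0%R, (i * r%:Z * h * u%:Z)%R, 0%R.
by rewrite binS bin1 PoszD intS Ex Ey EL EN; split; ring.
Qed.

Lemma iterBN s : iter N UB s = s.
Proof.
have [i [j [k ->]]] := phi_surj s; rewrite iterB; apply: phi_eq.
exists (i * h * E * u%:Z)%R, (E * v%:Z * k + E * v%:Z * (h - 1) * i)%R, i, 0%R.
by rewrite bin2_half Ex Ey EL EN; split; ring.
Qed.

Lemma commCA s : UC (UA s) = UA (UC s).
Proof.
have [i [j [k ->]]] := phi_surj s; rewrite !(UAE, UCE); apply: phi_eq.
exists (- E * u%:Z * u%:Z * k)%R, 0%R, (- j * v%:Z)%R, 0%R.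
by rewrite Ex Ey EL EN; split; ring.
Qed.

Lemma commCB s : UC (UB s) = UB (UC s).
Proof.
have [i [j [k ->]]] := phi_surj s; rewrite !(UBE, UCE); apply: phi_eq.
exists 0%R, (- E * v%:Z * v%:Z * k)%R, (- i * u%:Z)%R, 0%R.
by rewrite Ex Ey EL EN; split; ring.
Qed.

(** The two sides are the actions of B A C and A B on V. *)
Lemma commAB s : UC (UA (UB s)) = UB (UA s).
Proof.
have [i [j [k ->]]] := phi_surj s; rewrite !(UAE, UBE, UCE); apply: phi_eq.
exists (E * u%:Z * u%:Z * (h - 1) * (i + k))%R,
  (E * v%:Z * v%:Z * (k * (h - 1 - h * y%:Z) - h * j))%R, ((u%:Z - v%:Z) * k)%R, 0%R.
by rewrite Ex Ey EL EN; split; ring.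
Qed.

(** * The successive extensions by C, A and B *)

Section BaseC.
Variables (T1 : finGroupType) (i1 : {morphism [set: V] >-> T1}) (C1 : T1).
Hypothesis ext1 : cyclic_ext UC (phi 0 0 1) N i1 C1.
Let J i j k := i1 (phi i j k).

Let JD i j k i' j' k' : J (i + i')%R (j + j')%R (k + k')%R = J i j k * J i' j' k'.
Proof. by rewrite /J phiD morphM ?inE. Qed.

Let JN i j k : (J i j k)^-1 = J (- i)%R (- j)%R (- k)%R.
Proof. by rewrite /J phiN morphV ?inE. Qed.

Let i1C s t : i1 s * i1 t = i1 t * i1 s.
Proof. by rewrite -!morphM ?inE // phi_comm. Qed.

Let i1J s : i1 s ^ C1 = i1 (UC s). Proof. by case: ext1 => [[]]. Qed.

Let C1N : C1 ^+ N = J 0 0 1. Proof. by case: ext1 => [[]]. Qed.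

Lemma base1E s : exists r i j k, s = C1 ^+ r * J i j k.
Proof.
case: ext1 => _ _ S _; have [r [w ->]] := S s; have [i [j [k ->]]] := phi_surj w.
by exists r, i, j, k.
Qed.

Lemma C1_J0j0 j : C1 * J 0 j 0 = J 0 (j * (1 + y%:Z))%R 0 * C1.
Proof.
rewrite [RHS]conjgC i1J UCE; congr (_ * i1 _); apply: phi_eq.
exists 0%R, (j * E * v%:Z * v%:Z)%R, 0%R, 0%R.
by rewrite Ex Ey EL EN; split; ring.
Qed.

Lemma C1J_expg (c : int) r :
  (C1 * J c 0 0) ^+ r = C1 ^+ r * J (c * (geo x.+1 r)%:Z)%R 0 0.
Proof.
elim: r => [|r IH]; first by rewrite geo0 mulr0 /J phi0 morph1 mulg1.
rewrite expgSr IH -mulgA [J _ 0 0 * _]mulgA [J _ 0 0 * C1]conjgC i1J UCE.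
rewrite -[C1 * _ * _]mulgA [LHS]mulgA -expgSr -/(J _ _ _) -JD; congr (_ * J _ _ _).
- by rewrite geoSl PoszD PoszM -[x.+1]addn1 PoszD; ring.
- by ring.
Qed.

Lemma JC1_expg (c : int) r :
  (J 0 c 0 * C1) ^+ r = J 0 (c * (geo y.+1 r)%:Z)%R 0 * C1 ^+ r.
Proof.
elim: r => [|r IH]; first by rewrite geo0 mulr0 /J phi0 morph1 mulg1.
rewrite expgS IH -mulgA [C1 * (_ * _)]mulgA C1_J0j0 -!mulgA -expgS mulgA -JD !addr0.
congr (J _ _ _ * _); rewrite geoSl PoszD PoszM -[y.+1]addn1 PoszD; ring.
Qed.

(** [sA] is conjugation by the future A. It must send C to C A^-x, and A^x = (A^N)^u, whence the
    coordinate -u. Its N-th iterate has to be conjugation by A^N, which is [J 1 0 0]. *)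
Lemma sigmaA_exists : exists sA : T1 -> T1,
  [/\ {morph sA : s t / s * t}, forall s, sA (i1 s) = i1 (UA s),
     sA C1 = C1 * J (- u%:Z)%R 0 0 &
     sA (J 1 0 0) = J 1 0 0 /\ forall g, iter N sA g = g ^ J 1 0 0].
Proof.
have [_ _ _ UP] := ext1.
have uM : {morph (fun s => i1 (UA s)) : s t / s * t}.
  by move=> s t; rewrite UAM morphM ?inE.
have [||sA [sAM sAi sAC]] := UP T1 _ (C1 * J (- u%:Z)%R 0 0) uM.
- by move=> s; rewrite conjgM i1J commCA conjgE i1C mulKg.
- rewrite C1J_expg C1N -JD UAE; congr (i1 _); apply: phi_eq.
  exists (- u%:Z * u%:Z * E * (h - 1) - u%:Z * u%:Z * u%:Z * E * (geo3 x.+1 N)%:Z)%R, 0%R, 0%R, 0%R.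
  by rewrite geo_geo2 geo2_geo3 !(PoszD, PoszM) bin2_half ?Ex EL EN; split; ring.
exists sA; split=> //; split; first by rewrite sAi UAE; congr (i1 (phi _ _ _)); ring.
have iterM := iter_morph N sAM.
have iterJ r s : iter r sA (i1 s) = i1 (iter r UA s).
  by elim: r => // r IH; rewrite !iterS IH sAi.
have iterC1 r : iter r sA C1 = C1 * J (- r%:Z * u%:Z)%R 0 0.
  elim: r => [|r IH]; first by rewrite oppr0 mul0r /J phi0 morph1 mulg1.
  rewrite iterS IH sAM sAC sAi UAE -/(J _ _ _) -mulgA -JD; congr (_ * J _ _ _); ring.
move=> g; have [r [i [j [k ->]]]] := base1E g.
rewrite iterM iterJ iterAN (morphX_fun iterM) iterC1 conjMg conjXg.
congr (_ ^+ _ * _); last by rewrite conjgE i1C mulKg.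
rewrite [RHS]conjgE mulgA [_^-1 * C1]conjgC conjVg i1J UCE -/(J _ _ _) JN -mulgA -JD.
by congr (_ * J _ _ _); rewrite ?Ex ?EN; ring.
Qed.

Section BaseA.
Variable sA : T1 -> T1.
Hypotheses (sAM : {morph sA : s t / s * t}) (sAi : forall s, sA (i1 s) = i1 (UA s)).
Hypothesis sAC : sA C1 = C1 * J (- u%:Z)%R 0 0.
Variables (T2 : finGroupType) (i2 : {morphism [set: T1] >-> T2}) (A2 : T2).
Hypothesis ext2 : cyclic_ext sA (J 1 0 0) N i2 A2.
Let K i j k := i2 (J i j k).
Let c := i2 C1.

Let KD i j k i' j' k' : K (i + i')%R (j + j')%R (k + k')%R = K i j k * K i' j' k'.
Proof. by rewrite /K JD morphM ?inE. Qed.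

Let i2J s : i2 s ^ A2 = i2 (sA s). Proof. by case: ext2 => [[]]. Qed.

Let A2N : A2 ^+ N = K 1 0 0. Proof. by case: ext2 => [[]]. Qed.

Let K0 : K 0 0 0 = 1. Proof. by rewrite /K /J phi0 !morph1. Qed.

Lemma zexpg_K i j k e : zexpg (K i j k) e = K (i * e)%R (j * e)%R (k * e)%R.
Proof.
have E1 (n : nat) : zexpg (K i j k) n = K (i * n%:Z)%R (j * n%:Z)%R (k * n%:Z)%R.
  elim: n => [|n IH]; first by rewrite !mulr0 K0.
  by rewrite intS zexpgD IH !mulrDr !mulr1 KD.
case: e => n; first exact: E1.
rewrite NegzE zexpgN E1; apply: (mulgI (K (i * n.+1%:Z)%R (j * n.+1%:Z)%R (k * n.+1%:Z)%R)).
by rewrite mulgV -KD !mulrN !addrN K0.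
Qed.

Lemma A2_conj : A2 ^ c = A2 ^+ x.+1.
Proof.
have cA : c ^ A2 = c * K (- u%:Z)%R 0 0 by rewrite i2J sAC morphM ?inE.
have Ku : A2 ^+ x = K u%:Z 0 0.
  by rewrite /x expgM A2N -zexpg_nat zexpg_K mul1r.
rewrite expgS Ku.
apply: (mulgI c); rewrite -conjgC; apply: (mulIg (K (- u%:Z)%R 0 0)).
rewrite -[RHS]mulgA -[A2 * K _ _ _ * _]mulgA -KD addrN K0 mulg1.
by rewrite [c * A2]conjgC cA [RHS]mulgA.
Qed.

(** [tau] is conjugation by the future B on [T1], where C^B = B^y C and B^y = (B^N)^v. It takes
    values in [T2] because it will be the restriction required by the universal property of [T2]. *)
Lemma tau_exists : exists tau : T1 -> T2,
  [/\ {morph tau : s t / s * t}, forall s, tau (i1 s) = i2 (i1 (UB s)) &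
     tau C1 = i2 (J 0 v%:Z 0 * C1)].
Proof.
have [_ _ _ UP] := ext1.
have uM : {morph (fun s => i2 (i1 (UB s))) : s t / s * t}.
  by move=> s t; rewrite UBM !morphM ?inE.
have [||tau [tM ti tC]] := UP T2 _ (i2 (J 0 v%:Z 0 * C1)) uM.
- move=> s; rewrite -morphJ ?inE // conjgM.
  by rewrite [i1 _ ^ _]conjgE i1C mulKg i1J commCB.
- rewrite -morphX ?inE // JC1_expg C1N -JD UBE; congr (i2 (i1 _)); apply: phi_eq.
  exists 0%R, (v%:Z * v%:Z * E * (h - 1) + v%:Z * v%:Z * v%:Z * E * (geo3 y.+1 N)%:Z)%R, 0%R, 0%R.
  by rewrite geo_geo2 geo2_geo3 !(PoszD, PoszM) bin2_half ?Ey EL EN; split; ring.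
by exists tau.
Qed.

Section BaseT.
Variable tau : T1 -> T2.
Hypotheses (tM : {morph tau : s t / s * t}) (ti : forall s, tau (i1 s) = i2 (i1 (UB s))).
Hypothesis tC : tau C1 = i2 (J 0 v%:Z 0 * C1).

Lemma sigmaB_exists : exists sB : T2 -> T2,
  [/\ {morph sB : s t / s * t}, forall s, sB (i2 s) = tau s, sB A2 = A2 * c &
     sB (K 0 1 0) = K 0 1 0 /\ forall g, iter N sB g = g ^ K 0 1 0].
Proof.
have [_ _ _ UP] := ext2.
have [||sB [sBM sBi sBA]] := UP T2 _ (A2 * c) tM.
- move=> g; have [r [i [j [k ->]]]] := base1E g.
  rewrite !(sAM, tM, conjMg); congr (_ * _).
    rewrite (morphX_fun sAM) !(morphX_fun tM) conjXg; congr (_ ^+ _).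
    rewrite sAC tM tC ti conjgM i2J sAM sAi sAC -morphJ ?inE // -morphM ?inE //.
    congr (i2 _); rewrite !conjMg !i1J [C1 ^ C1]conjgE mulKg UAE UBE !UCE.
    rewrite [LHS]mulgA [i1 _ * C1]conjgC i1J UCE [J 0 _ 0 * C1]conjgC i1J UCE -!mulgA.
    congr (C1 * _); rewrite -!morphM ?inE // -!phiD; congr (i1 _); apply: phi_eq.
    (* Compatibility of the future B with C^A holds modulo the key relation, used here with
       coefficient -1; this is the reason for its presence in the lattice. *)
    exists (E * u%:Z * u%:Z)%R, (E * v%:Z * v%:Z + E * v%:Z * v%:Z * v%:Z * (1 - 2 * h + h * y%:Z))%R,
      0%R, (- 1)%R; rewrite Ex Ey EL EN ED; split.
    + by apply: (eq_of_sub0 (e := Q * E * u%:Z * u%:Z * (h * 2 - (1 + Q * E)))%R);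
        [ring | rewrite Eh subrr mulr0].
    + by apply: (eq_of_sub0 (e := Q * E * v%:Z * v%:Z * (h * 2 - (1 + Q * E)))%R);
        [ring | rewrite Eh subrr mulr0].
    + by rewrite Eu; ring.
  by rewrite !ti !conjgM i2J sAi -morphJ ?inE // i1J commAB sAi ti.
- have [k Ek] := geo3_bin x N.
  rewrite (conjX_expgM _ A2_conj) /c -morphX ?inE // C1N.
  pose e := ((1 + x%:Z) * (1 + x%:Z * (h - 1) + u%:Z * x%:Z * (geo3 x.+1 N)%:Z))%R.
  have -> : A2 ^+ (x.+1 * geo x.+1 N) = K e 0 0.
    rewrite -zexpg_nat (_ : Posz _ = N%:Z * e)%R.
      by rewrite zexpgM zexpg_nat A2N zexpg_K mul1r !mul0r.
    by rewrite PoszM geo_geo2 geo2_geo3 intS !(PoszD, PoszM) bin2_half /e ?Ex EN; ring.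
  rewrite -KD ti UBE; congr (i2 (i1 _)); apply: phi_eq.
  exists (E * u%:Z * u%:Z * (h - 1) + (1 + x%:Z) * u%:Z * u%:Z * (c3 + E * u%:Z * k%:Z))%R, 0%R, 0%R, 0%R.
  split; try by ring.
  apply: (eq_of_sub0 (e := (1 + x%:Z) * u%:Z * u%:Z * (N%:Z * 'C(N, 3)%:Z - Q * E * Q * c3))%R).
    by rewrite /e Ek PoszD PoszM EL !Ex EN; ring.
  by rewrite Ec3 subrr mulr0.
exists sB; split=> //; split.
  by rewrite sBi ti UBE; congr (i2 (i1 (phi _ _ _))); ring.
have iterM := iter_morph N sBM.
have iterJ r s : iter r sB (i2 (i1 s)) = i2 (i1 (iter r UB s)).
  by elim: r => // r IH; rewrite !iterS IH sBi ti.
have iterC1 r : iter r sB c = K 0 (r%:Z * v%:Z)%R 0 * c.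
  elim: r => [|r IH]; first by rewrite mul0r K0 mul1g.
  rewrite iterS IH sBM !sBi ti UBE tC morphM ?inE // mulgA; congr (_ * _).
  rewrite -[LHS]KD; congr K; rewrite ?intS; ring.
(* Each conjugation by B adds a factor C after A and releases powers of B from the earlier factors
   C; these powers accumulate in [wsum]. *)
have iterA2 r : iter r sB A2 = A2 * (K 0 (v%:Z * (wsum y.+1 r)%:Z)%R 0 * c ^+ r).
  elim: r => [|r IH]; first by rewrite mulr0 K0 !mulg1.
  rewrite iterS IH !sBM sBA (morphX_fun sBM) !sBi ti UBE tC -morphX ?inE // JC1_expg.
  rewrite -mulgA; congr (A2 * _); rewrite /c /K -!morphX ?inE // -!morphM ?inE //.
  congr (i2 _); rewrite !mulgA -[C1 * _ * _]mulgA -JD.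
  have -> : J (0 * (1 + h * x%:Z) + 0)%R
      (v%:Z * (wsum y.+1 r)%:Z + y%:Z * 0 + v%:Z * (geo y.+1 r)%:Z)%R (0 + 0 + 0)%R
    = J 0 (v%:Z * ((wsum y.+1 r)%:Z + (geo y.+1 r)%:Z))%R 0 by congr J; ring.
  rewrite C1_J0j0 -mulgA -expgS; congr (J _ _ _ * _).
  by rewrite /= PoszM PoszD intS; ring.
have KN i j k : (K i j k)^-1 = K (- i)%R (- j)%R (- k)%R.
  by rewrite /K -JN morphV ?inE.
have cN : c ^+ N = K 0 0 1 by rewrite /c -morphX ?inE // C1N.
have iterC1N : iter N sB c = c ^ K 0 1 0.
  rewrite iterC1 conjgE KN /c /K -!morphM ?inE // C1_J0j0 mulgA -JD; congr (i2 (J _ _ _ * _)).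
  by rewrite ?Ey EN; ring.
have iterA2N : iter N sB A2 = A2 ^ K 0 1 0.
  rewrite iterA2 cN conjgE KN [RHS]mulgA [K _ _ _ * A2]conjgC i2J sAi UAE -mulgA.
  congr (A2 * _); rewrite -KD -[RHS]KD.
  (* Modulo L the sum is 'C(N, 2) = N (h - 1), and v N (h - 1) = - h y + y N, where L divides y
     N. *)
  have [g Eg] := wsum_bin y N.
  congr (i2 (i1 _)); apply: phi_eq.
  exists 0%R, (v%:Z * (E + 2 * v%:Z * c3 + E * v%:Z * (h - 1) + E * v%:Z * v%:Z * g%:Z))%R, 0%R, 0%R.
  split; try by ring.
  apply: (eq_of_sub0 (e := v%:Z * (Q * E * (h * 2 - (1 + Q * E))
     + 2 * v%:Z * (N%:Z * 'C(N, 3)%:Z - Q * E * Q * c3)))%R).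
    by rewrite Eg !(PoszD, PoszM) bin2_half ?Ey EL EN; ring.
  by rewrite Ec3 Eh !subrr; ring.
move=> g; have [_ _ S _] := ext2; have [r [w ->]] := S g.
have [r' [i [j [k ->]]]] := base1E w.
rewrite morphM ?inE // morphX ?inE // !(iterM, conjMg) !(morphX_fun iterM) !conjXg.
rewrite iterA2N iterC1N iterJ iterBN; congr (_ * (_ * _)).
by rewrite -morphJ ?inE // [i1 _ ^ _]conjgE i1C mulKg.
Qed.

Section BaseB.
Variable sB : T2 -> T2.
Hypotheses (sBi : forall s, sB (i2 s) = tau s) (sBA : sB A2 = A2 * c).
Variables (T3 : finGroupType) (i3 : {morphism [set: T2] >-> T3}) (B3 : T3).
Hypothesis ext3 : cyclic_ext sB (K 0 1 0) N i3 B3.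

Lemma tower_model : macd_model L N u v h D (i3 A2) B3 (fun i j k => i3 (K i j k)).
Proof.
have [[inj3 i3J B3N card3] _ S3 _] := ext3.
have [[inj2 _ _ card2] _ S2 _] := ext2.
have [[inj1 _ _ card1] _ S1 _] := ext1.
have eqC : [~ i3 A2, B3] = i3 c.
  by rewrite commgEl i3J sBA morphM ?inE // mulKg.
have CB : i3 c ^ B3 = i3 (K 0 v%:Z 0) * i3 c.
  by rewrite i3J sBi tC /c -!morphM ?inE.
have yK : B3 ^+ y = i3 (K 0 v%:Z 0).
  by rewrite /y expgM B3N -morphX ?inE // -zexpg_nat zexpg_K mul1r !mul0r.
split.
- by move=> *; rewrite KD morphM ?inE.
- move=> i j k; split=> [E1|/phi_ker E1]; last by rewrite /K /J E1 !morph1.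
  apply/phi_ker.
  apply/eqP; rewrite -(morph_injm_eq1 inj1) ?inE // -(morph_injm_eq1 inj2) ?inE //.
  by rewrite -(morph_injm_eq1 inj3) ?inE //; apply/eqP.
- split.
    by rewrite eqC -morphJ ?inE // A2_conj morphX ?inE.
  rewrite -invg_comm eqC conjgE invgK; apply: (mulIg (i3 c)).
  by rewrite -!mulgA mulVg mulg1 expgS yK -mulgA -CB -conjgC.
- by rewrite -morphX ?inE // A2N.
- by rewrite B3N.
- by rewrite eqC -morphX ?inE // /c -morphX ?inE // C1N.
- by move=> i j k; rewrite -morphJ ?inE // i2J sAi UAE.
- by move=> i j k; rewrite i3J sBi ti UBE.
- by rewrite eqC -morphJ ?inE // i2J sAC !morphM ?inE.
- by rewrite eqC CB.
set H := <<_>>; have AH : i3 A2 \in H by rewrite mem_gen // !inE eqxx.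
have BH : B3 \in H by rewrite mem_gen // !inE eqxx orbT.
have CH : i3 c \in H by rewrite -eqC groupR.
have PH i j k : i3 (K i j k) \in H.
  have -> : i3 (K i j k) = zexpg (i3 (K 1 0 0)) i * zexpg (i3 (K 0 1 0)) j * zexpg (i3 (K 0 0 1)) k.
    have zi s e : zexpg (i3 s) e = i3 (zexpg s e).
      by case: e => n; rewrite /= -?morphV -?morphX ?inE // -morphV ?inE.
    rewrite !zi !zexpg_K -!(morphM i3) ?inE // -!KD; congr (i3 (K _ _ _)); ring.
  have Hz s e : s \in H -> zexpg s e \in H.
    by move=> sH; case: e => n; rewrite /= ?groupV groupX.
  rewrite !groupM ?Hz // -?B3N -?A2N; first by rewrite morphX ?inE // groupX.
    by rewrite groupX.
  by rewrite /K -C1N !morphX ?inE // groupX.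
apply/eqP; rewrite eqEsubset subsetT andbT; apply/subsetP=> s _.
have [r [w ->]] := S3 s; have [r' [w' ->]] := S2 w.
have [r'' [i [j [k ->]]]] := base1E w'.
rewrite groupM ?groupX // morphM ?inE // groupM //; first by rewrite morphX ?inE // groupX.
rewrite !(morphM, morphX) ?inE // groupM //; last exact: PH.
by rewrite groupX.
Qed.

Lemma tower_card : #|T3| = (N * (N * (N * #|V|)))%N.
Proof.
have [[_ _ _ card3] _ _ _] := ext3; have [[_ _ _ card2] _ _ _] := ext2.
have [[_ _ _ card1] _ _ _] := ext1; by rewrite card3 card2 card1.
Qed.


End BaseB.
End BaseT.
End BaseA.
End BaseC.

End Tower.

Lemma macd_model_exists (L N u v : nat) (h D Q E d c3 w f w' : int) :
    1 < L -> 1 < N ->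
    (N%:Z = Q * E -> L%:Z = Q * E * Q -> D = Q * d -> u%:Z = v%:Z + Q * d ->
     h * 2 = 1 + Q * E -> N%:Z * 'C(N, 3)%:Z = Q * E * Q * c3 ->
     Q * Q = N%:Z * f -> v%:Z * v%:Z * w = 1 + L%:Z * w' ->
     (forall c, (Q %| u%:Z * u%:Z * w * c)%Z -> (Q %| c)%Z) ->
  exists (T : finGroupType) (A B : T) (P : int -> int -> int -> T),
    [/\ macd_model L N u v h D A B P,
        #|T| = (N * (N * (N * (N * (L * N)))))%N &
        [/\ forall i, P i 0 0 = 1%g -> (L %| i)%Z,
            forall j, P 0 j 0 = 1%g -> (L %| j)%Z &
            forall k, P 0 0 k = 1%g -> (N %| k)%Z]])%R.
Proof.
move=> L1 N1 EN EL ED Eu Eh Ec3 Ef Ew cop.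
have [|||V [phi [phiD phi_surj cardV phi_ker [ordA ordB ordC]]]] :=
  @abelian_base L N h u v w D Q d f E w' L1 N1 _ _ ED Ef Ew _ cop.
- by rewrite EL EN; ring.
- by rewrite EL EN; ring.
- by rewrite EN.
have [UC [UCM UCE]] := endoC EN EL ED phiD phi_surj phi_ker.
have [UA [UAM UAE]] := endoA EN EL ED phiD phi_surj phi_ker.
have [UB [UBM UBE]] := endoB EN EL ED phiD phi_surj phi_ker.
have phiC := phi_comm phiD phi_surj.
have [||T1 [i1 [C1 ext1]]] := @cyclic_ext_exists V UC (phi 0 0 1)%R N UCM _ N1.
- by rewrite UCE; congr phi; ring.
- move=> s; rewrite conjgE [s * _]phiC mulKg; exact: (iterCN EN EL phiD phi_surj phi_ker UCE).
have [sA [sAM sAi sAC [sA1 sAN]]] :=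
  sigmaA_exists N1 EN EL Eh phiD phi_surj phi_ker UAM UCE UAE ext1.
have [T2 [i2 [A2 ext2]]] := cyclic_ext_exists sAM sA1 N1 sAN.
have [tau [tM ti tC]] :=
  tau_exists N1 EN EL Eh phiD phi_surj phi_ker UBM UCE UBE ext1 i2.
have [sB [sBM sBi sBA [sB1 sBN]]] :=
  sigmaB_exists N1 EN EL ED Eu Eh Ec3 phiD phi_surj phi_ker UCE UAE UBE ext1
    sAM sAi sAC ext2 tM ti tC.
have [T3 [i3 [B3 ext3]]] := cyclic_ext_exists sBM sB1 N1 sBN.
have model := tower_model phiD phi_surj phi_ker UAE UBE ext1 sAi sAC ext2 ti tC sBi sBA ext3.
exists T3, (i3 A2), B3, (fun i j k => i3 (i2 (i1 (phi i j k)))); split=> //.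
  by rewrite (tower_card ext1 ext2 ext3) cardV.
have E1 i j k : i3 (i2 (i1 (phi i j k))) = 1 -> phi i j k = 1.
  by move/(model_ker model)/phi_ker.
by split=> i /E1; [apply: ordA | apply: ordB | apply: ordC].
Qed.

(** * Nilpotency class of the model *)

Lemma commg_gen_step (gT : finGroupType) (A B : gT) (X Y : {set gT}) :
    [set: gT] = <<[set A; B]>> -> Y \subset <<X>> ->
    (forall z, z \in X -> [~ z, A] \in <<Y>> /\ [~ z, B] \in <<Y>>) ->
    [set: gT] \subset 'N(<<Y>>) ->
  [set: gT] \subset 'N(<<X>>) /\ [~: <<X>>, [set: gT]] \subset <<Y>>.
Proof.
move=> defT YX XY nY; have sYX : <<Y>> \subset <<X>> by rewrite gen_subG.
split.
  rewrite defT gen_subG subUset !sub1set !inE -!genJ !gen_subG.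
  have step z t : z \in X -> [~ z, t] \in <<Y>> -> z ^ t \in <<X>>.
    move=> zX ztY; rewrite -(mulKVg z (z ^ t)) -commgEl.
    by apply: groupM; [apply: mem_gen | apply: (subsetP sYX)].
  by apply/andP; split; apply/subsetP=> _ /imsetP[z zX ->]; apply: step => //;
    have [] := XY z zX.
(* Modulo [<<Y>>] the elements of X commute with A and B, hence with the whole group. *)
rewrite -quotient_cents2 ?nY ?(subset_trans (subsetT _) nY) // defT !quotient_gen; last 2 first.
- by apply: subset_trans (subsetT _) nY.
- by apply: subset_trans (subsetT _) nY.
rewrite cent_gen gen_subG; apply/subsetP=> _ /morphimP[z nz zX ->].
apply/centP=> _ /morphimP[t nt tAB ->]; apply/commgP; rewrite -morphR //.
have [zA zB] := XY z zX.
by move: tAB; rewrite !inE => /orP[]/eqP->; apply/eqP; apply: coset_id.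
Qed.

Section ModelClass.
Variables (L N u v : nat) (h D E : int) (T : finGroupType) (A B : T).
Variable P : int -> int -> int -> T.
Hypothesis model : macd_model L N u v h D A B P.
Hypothesis EN : (N%:Z * N%:Z = L%:Z * E)%R.
Let C := [~ A, B].
Let PD := modelD model.

Let P0 : P 0%R 0%R 0%R = 1.
Proof. by apply: (mulgI (P 0%R 0%R 0%R)); rewrite -PD !addr0 mulg1. Qed.

Let PN i j k : (P i j k)^-1 = P (- i)%R (- j)%R (- k)%R.
Proof. by apply: (mulgI (P i j k)); rewrite mulgV -PD !addrN P0. Qed.

Lemma model_zexpg i j k e : zexpg (P i j k) e = P (i * e)%R (j * e)%R (k * e)%R.
Proof.
have E1 (n : nat) : zexpg (P i j k) n = P (i * n%:Z)%R (j * n%:Z)%R (k * n%:Z)%R.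
  elim: n => [|n IH]; first by rewrite !mulr0 P0.
  by rewrite intS zexpgD IH !mulrDr !mulr1 PD.
by case: e => n; rewrite ?NegzE ?zexpgN E1 // PN -!mulrN.
Qed.

Let groupZ (H : {group T}) s e : s \in H -> zexpg s e \in H.
Proof. by move=> sH; case: e => n; rewrite /= ?groupV groupX. Qed.

Let P_lat i j k : lattice3 L N h u v D i j k -> P i j k = 1.
Proof. by case: (model_ker model i j k). Qed.

Let PA i j k : [~ P i j k, A] = P (- (N * u)%N%:Z * k)%R (j * h * (N * v)%N%:Z)%R (- j)%R.
Proof. by rewrite commgEl PN (modelPA model) -PD; congr P; ring. Qed.

Let PB i j k : [~ P i j k, B] = P (i * h * (N * u)%N%:Z)%R ((N * v)%N%:Z * k)%R i.
Proof. by rewrite commgEl PN (modelPB model) -PD; congr P; ring. Qed.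

(** Generators of subgroups containing the terms 'L_5 to 'L_2: first A^(N^2) and B^(N^2), then also
    C^N, then A^N and B^N, and finally C. *)
Let X5 := [set P N 0%R 0%R; P 0%R N 0%R].
Let X4 := P 0%R 0%R 1%R |: X5.
Let X3 := [set P 1%R 0%R 0%R; P 0%R 1%R 0%R] :|: X4.
Let X2 := C |: X3.

Let mem5 i j k : P (N%:Z * i)%R (N%:Z * j)%R (N%:Z * k)%R \in <<X5>>.
Proof.
have -> : P (N%:Z * i)%R (N%:Z * j)%R (N%:Z * k)%R =
    zexpg (P N 0%R 0%R) i * zexpg (P 0%R N 0%R) j * P 0%R 0%R (N%:Z * k)%R.
  by rewrite !model_zexpg -!PD; congr P; ring.
rewrite [P _ _ (_ * k)%R]P_lat ?mulg1; last by exists 0%R, 0%R, k, 0%R; split; ring.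
by rewrite groupM ?groupZ // mem_gen // !inE eqxx ?orbT.
Qed.

Let mem4 i j k : P (N%:Z * i)%R (N%:Z * j)%R k \in <<X4>>.
Proof.
have -> : P (N%:Z * i)%R (N%:Z * j)%R k =
    P (N%:Z * i)%R (N%:Z * j)%R (N%:Z * 0)%R * zexpg (P 0%R 0%R 1%R) k.
  by rewrite !model_zexpg -PD; congr P; ring.
rewrite groupM ?groupZ //; last by rewrite mem_gen // !inE eqxx.
by apply: (subsetP (genS (subsetUr _ _))) (mem5 i j 0%R).
Qed.

Let mem3 i j k : P i j k \in <<X3>>.
Proof.
have -> : P i j k = zexpg (P 1%R 0%R 0%R) i * zexpg (P 0%R 1%R 0%R) j * zexpg (P 0%R 0%R 1%R) k.
  by rewrite !model_zexpg -!PD; congr P; ring.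
by rewrite !groupM ?groupZ // mem_gen // !inE eqxx ?orbT.
Qed.

Lemma model_lcn6 : 'L_6([set: T]) = 1.
Proof.
have defT := model_gen model.
have n6 : [set: T] \subset 'N(<<set0 : {set T}>>) by rewrite gen0 norms1.
have [n5 c5] : [set: T] \subset 'N(<<X5>>) /\ [~: <<X5>>, [set: T]] \subset <<set0>>.
  apply: commg_gen_step defT (sub0set _) _ n6 => z.
  rewrite gen0 !inE => /orP[]/eqP->; rewrite PA PB; split; apply/eqP/P_lat.
  - by exists 0%R, 0%R, 0%R, 0%R; split; ring.
  - exists (h * u%:Z * E)%R, 0%R, 1%R, 0%R; rewrite PoszM; split; try ring.
    apply: (eq_of_sub0 (e := h * u%:Z * (N%:Z * N%:Z - L%:Z * E))%R); first by ring.
    by rewrite EN subrr mulr0.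
  - exists 0%R, (h * v%:Z * E)%R, (- 1)%R, 0%R; rewrite PoszM; split; try ring.
    apply: (eq_of_sub0 (e := h * v%:Z * (N%:Z * N%:Z - L%:Z * E))%R); first by ring.
    by rewrite EN subrr mulr0.
  - by exists 0%R, 0%R, 0%R, 0%R; split; ring.
have [n4 c4] : [set: T] \subset 'N(<<X4>>) /\ [~: <<X4>>, [set: T]] \subset <<X5>>.
  apply: commg_gen_step defT _ _ n5 => [|z].
    by apply: subset_trans (subset_gen _) (genS _); apply: subsetUr.
  rewrite !inE => /or3P[]/eqP->; rewrite PA PB !PoszM; split.
  - rewrite (_ : P _ _ _ = P (N%:Z * (- u%:Z)) (N%:Z * 0) (N%:Z * 0))%R; [exact: mem5 | congr P; ring].
  - rewrite (_ : P _ _ _ = P (N%:Z * 0) (N%:Z * v%:Z) (N%:Z * 0))%R; [exact: mem5 | congr P; ring].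
  - rewrite (_ : P _ _ _ = P (N%:Z * 0) (N%:Z * 0) (N%:Z * 0))%R; [exact: mem5 | congr P; ring].
  - rewrite (_ : P _ _ _ = P (N%:Z * (h * N%:Z * u%:Z)) (N%:Z * 0) (N%:Z * 1))%R;
      [exact: mem5 | congr P; ring].
  - rewrite (_ : P _ _ _ = P (N%:Z * 0) (N%:Z * (h * N%:Z * v%:Z)) (N%:Z * (- 1)))%R;
      [exact: mem5 | congr P; ring].
  - rewrite (_ : P _ _ _ = P (N%:Z * 0) (N%:Z * 0) (N%:Z * 0))%R; [exact: mem5 | congr P; ring].
have [n3 c3] : [set: T] \subset 'N(<<X3>>) /\ [~: <<X3>>, [set: T]] \subset <<X4>>.
  apply: commg_gen_step defT _ _ n4 => [|z].
    by apply: subset_trans (subset_gen _) (genS _); apply: subsetUr.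
  move=> zX; have [i [j [k ->]]] : exists i j k, z = P i j k.
    by move: zX; rewrite !inE -!orbA => /or4P[||| /orP[]] /eqP->; do 3!eexists.
  rewrite PA PB !PoszM; split.
    rewrite (_ : P _ _ _ = P (N%:Z * (- u%:Z * k)) (N%:Z * (j * h * v%:Z)) (- j))%R;
      [exact: mem4 | congr P; ring].
  rewrite (_ : P _ _ _ = P (N%:Z * (i * h * u%:Z)) (N%:Z * (v%:Z * k)) i)%R;
    [exact: mem4 | congr P; ring].
have CX : C \in 'N(<<X3>>) by apply: (subsetP n3); rewrite inE.
have [n2 c2] : [set: T] \subset 'N(<<X2>>) /\ [~: <<X2>>, [set: T]] \subset <<X3>>.
  apply: (commg_gen_step defT _ _ n3) => [|z].
    by apply: subset_trans (subset_gen _) (genS _); apply: subsetUr.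
  rewrite in_setU1 => /predU1P[->|zX3].
    split; rewrite commgEl -/C.
      by rewrite /C (modelCA model) mulKg mem3.
    by rewrite /C (modelCB model) -/C -conjgE memJ_norm // mem3.
  have zX : z \in <<X3>> by rewrite mem_gen.
  by split; rewrite commgEl groupM ?groupV // memJ_norm // (subsetP n3) ?inE.
have c1 : [~: [set: T], [set: T]] \subset <<X2>>.
  have CX2 : C \in <<X2>> by rewrite mem_gen // in_setU1 eqxx.
  have [||_] := @commg_gen_step _ A B [set A; B] X2 defT _ _ n2; last by rewrite -defT.
    by rewrite -defT subsetT.
  move=> z; rewrite !inE => /orP[]/eqP->; rewrite ?commgg group1; split=> //.
  by rewrite -invg_comm groupV.
apply/trivgP; rewrite /= -(gen0 T).
have step n (H K : {set T}) : 'L_n.+1([set: T]) \subset H -> [~: H, [set: T]] \subset K ->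
    'L_n.+2([set: T]) \subset K.
  by move=> LH; apply: subset_trans; rewrite lcnSn commSg.
apply: (step 4 _ _ _ c5); apply: (step 3 _ _ _ c4); apply: (step 2 _ _ _ c3).
by apply: (step 1%N _ _ _ c2); apply: (step 0 _ _ _ c1); rewrite lcn1.
Qed.

Hypothesis ordA : forall i, P i 0%R 0%R = 1 -> (L %| i)%Z.
Hypothesis ndvd : ~~ (L %| N * u * u)%N.

(** The commutator [[[C, A], B], A] is A^(N^2 u^2): the first step gives A^(-N u), the second
    contributes C^(-N u), and A turns this into a power of A. *)
Lemma model_lcn5 : 'L_5([set: T]) != 1.
Proof.
have inT (t : T) : t \in [set: T] by rewrite inE.
have step n z t : z \in 'L_n.+1([set: T]) -> [~ z, t] \in 'L_n.+2([set: T]).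
  by move=> zL; rewrite lcnSn mem_commg.
have C2 : C \in 'L_2([set: T]) by apply: step; rewrite lcn1.
have := step _ _ A C2; rewrite commgEl /C (modelCA model) mulKg => L3.
have := step _ _ A (step _ _ B L3); rewrite PB PA => L5.
apply: contraNneq ndvd => L51; move: L5; rewrite L51 => /set1P.
rewrite (_ : P _ _ _ = P (N * u * u)%N%:Z 0 0)%R; last by rewrite !PoszM; congr P; ring.
by move/ordA.
Qed.

Lemma model_nil_class : nilpotent [set: T] -> nil_class [set: T] = 5.
Proof.
move=> nilT; apply/eqP; rewrite eqn_leq; apply/andP; split.
  by apply/lcn_nil_classP => //; apply: model_lcn6.
rewrite ltnNge; apply: contra model_lcn5 => le4.
by apply/eqP/lcn_nil_classP.
Qed.

End ModelClass.

(** * The model for given p, m and l *)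

Lemma order_p_root (gT : finGroupType) (p : nat) (a : gT) m l :
  prime p -> p.-elt a -> 0 < l -> #[a ^+ (p ^ m)] = (p ^ l)%N -> #[a] = (p ^ (m + l))%N.
Proof.
move=> p_pr /p_natP[e oa] l0; rewrite orderXgcd oa.
have [em|me] := leqP e m.
  rewrite (gcdn_idPl _) ?dvdn_exp2l // divnn expn_gt0 prime_gt0 // => /esym/eqP.
  by rewrite -[X in _ == X](expn0 p) eqn_exp2l ?prime_gt1 // => /eqP l_0; rewrite l_0 in l0.
have me' := ltnW me; rewrite (gcdn_idPr (dvdn_exp2l p me')) -expnB ?prime_gt0 // => /eqP.
by rewrite eqn_exp2l ?prime_gt1 // => /eqP <-; rewrite subnKC.
Qed.

Lemma macd_p_model (p m l u v d : nat) :
    prime p -> odd p -> m < l -> l < 2 * m -> 3 * m < 2 * l ->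
    coprime p u -> coprime p v -> u = (v + p ^ (l - m) * d)%N ->
  exists (T : finGroupType) (A B : T),
    [/\ macd (p ^ m * u)%N (p ^ m * v)%N A B, [set: T] = <<[set A; B]>>,
        #|T| = (p ^ (5 * m + l))%N, nil_class [set: T] = 5 &
        [/\ #[A] = p ^ (m + l), #[B] = p ^ (m + l) & #[[~ A, B]] = p ^ (2 * m)]%N].
Proof.
move=> p_pr p_odd ml l2m m3l2 cpu cpv Euv; have p0 := prime_gt0 p_pr.
have p1 := prime_gt1 p_pr.
have v0 : 0 < v.
  by have [v_0|//] := posnP v; move: cpv; rewrite v_0 /coprime gcdn0 gtn_eqF.
pose N := (p ^ m)%N; pose L := (p ^ l)%N; pose Q := (p ^ (l - m))%N.
pose E := (p ^ (2 * m - l))%N; pose f := (p ^ (2 * l - 3 * m))%N.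
have N1 : 1 < N by rewrite -(expn0 p) ltn_exp2l //; lia.
have L1 : 1 < L by rewrite -(expn0 p) ltn_exp2l //; lia.
have EN : N = (Q * E)%N by rewrite /N /Q /E -expnD; congr (p ^ _)%N; lia.
have EL : L = (Q * E * Q)%N by rewrite /L /Q /E -!expnD; congr (p ^ _)%N; lia.
have Ef : (Q * Q = N * f)%N by rewrite /Q /N /f -!expnD; congr (p ^ _)%N; lia.
have oddN : odd N by rewrite oddX p_odd orbT.
pose h := (N./2.+1)%N.
have Eh : (h * 2 = 1 + N)%N.
  by rewrite -[X in _ = 1 + X](odd_double_half N) oddN /h -muln2; lia.
(* The denominator 6 of 'C(N, 3) costs at most one factor p, and only for p = 3; since l <= 2m - 1
   this is affordable. *)
have [c3 Ec3] : exists c3, (N * 'C(N, 3) = L * c3)%N.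
  have pC : p ^ m.-1 %| 'C(N, 3).
    have C6 : (6 * 'C(N, 3) = N * (N.-1 * N.-2))%N.
      by rewrite -[6]/(2 * 3)%N -mulnA -mul_bin_diag mulnCA -[2]/(1.+1) -mul_bin_diag bin1.
    have : p ^ m %| 6 * 'C(N, 3) by rewrite C6 dvdn_mulr.
    rewrite -[6]/(2 * 3)%N -mulnA => /(odd_dvd_double p_pr p_odd).
    have m0 : 0 < m by lia.
    have [->|p3] := eqVneq p 3; first by rewrite -{1}(prednK m0) expnS dvdn_pmul2l.
    rewrite Gauss_dvdr; last by rewrite coprimeXl // prime_coprime // dvdn_prime2.
    by apply: dvdn_trans; rewrite dvdn_exp2l // leq_pred.
  have /dvdnP[k Ek] : L %| N * 'C(N, 3).
    apply: dvdn_trans (dvdn_mul (dvdnn N) pC).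
    by rewrite /N -expnD dvdn_exp2l //; lia.
  by exists k; rewrite Ek mulnC.
(* By Euler's theorem a power of v^2 inverts v^2 modulo L. *)
have [w [w' Ew] cpw] : exists2 w, (exists w', v * v * w = 1 + L * w')%N & coprime p w.
  have cL : coprime (v * v) L by rewrite coprime_sym coprimeXl // coprimeMr cpv.
  have t0 : 0 < totient L by rewrite totient_gt0 ltnW.
  exists ((v * v) ^ (totient L).-1)%N; last by rewrite coprimeXr // coprimeMr cpv.
  have /eqP := Euler_exp_totient cL; rewrite eqn_mod_dvd ?expn_gt0 ?muln_gt0 ?v0 //.
  case/dvdnP=> w' Ew; exists w'; rewrite -expnS prednK // mulnC -Ew subnKC //.
  by rewrite expn_gt0 muln_gt0 v0.
have cop c : (Q%:Z %| (u%:Z * u%:Z * w%:Z * c)%R)%Z -> (Q %| c)%Z.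
  rewrite Gauss_dvdzr // -!PoszM coprimezE !absz_nat.
  by rewrite coprimeXl // !coprimeMr cpu.
have zN : (N%:Z = Q%:Z * E%:Z)%R by rewrite -PoszM -EN.
have zL : (L%:Z = Q%:Z * E%:Z * Q%:Z)%R by rewrite -!PoszM -EL.
have zu : (u%:Z = v%:Z + Q%:Z * d%:Z)%R by rewrite -PoszM -PoszD -Euv.
have zh : (h%:Z * 2 = 1 + Q%:Z * E%:Z)%R by rewrite -zN; move: Eh; lia.
have zc : (N%:Z * 'C(N, 3)%:Z = Q%:Z * E%:Z * Q%:Z * c3%:Z)%R by rewrite -zL -!PoszM Ec3.
have zf : (Q%:Z * Q%:Z = N%:Z * f%:Z)%R by rewrite -!PoszM Ef.
have zw : (v%:Z * v%:Z * w%:Z = 1 + L%:Z * w'%:Z)%R by rewrite -!PoszM Ew PoszD.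
have [T [A [B [P [model cardT [ordA ordB ordC]]]]]] :=
  macd_model_exists L1 N1 zN zL erefl zu zh zc zf zw cop.
have cardE : #|T| = (p ^ (5 * m + l))%N.
  rewrite cardT /N /L -!expnD; congr (p ^ _)%N; lia.
have pT : p.-group [set: T] by rewrite /pgroup cardsT cardE pnatX pnat_id.
have pelt (t : T) : p.-elt t by apply: mem_p_elt pT _; rewrite inE.
have zN2 : (N%:Z * N%:Z = L%:Z * E%:Z)%R by rewrite zL zN; ring.
have order_eq (g : T) (n : nat) : g ^+ n = 1 -> (forall k, g ^+ k = 1 -> n %| k) -> #[g] = n.
  by move=> gn1 gk; apply/eqP; rewrite eqn_dvd order_dvdn gn1 eqxx gk // expg_order.
have Pexp (i j k : int) r : P i j k ^+ r = P (i * r%:Z)%R (j * r%:Z)%R (k * r%:Z)%R.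
  by rewrite -(model_zexpg model).
have lat i j k := (model_ker model i j k).2.
have oA : #[A] = (p ^ (m + l))%N.
  apply: (order_p_root p_pr (pelt _)); first by lia.
  rewrite (modelA model); apply: order_eq => [|k].
    by rewrite Pexp; apply: lat; exists 1%R, 0%R, 0%R, 0%R; split; ring.
  by rewrite Pexp !mul0r mul1r => /ordA.
have oB : #[B] = (p ^ (m + l))%N.
  apply: (order_p_root p_pr (pelt _)); first by lia.
  rewrite (modelB model); apply: order_eq => [|k].
    by rewrite Pexp; apply: lat; exists 0%R, 1%R, 0%R, 0%R; split; ring.
  by rewrite Pexp !mul0r mul1r => /ordB.
have oC : #[[~ A, B]] = (p ^ (2 * m))%N.
  rewrite mul2n -addnn; apply: (order_p_root p_pr (pelt _)); first by lia.
  rewrite (modelC model); apply: order_eq => [|k].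
    by rewrite Pexp; apply: lat; exists 0%R, 0%R, 1%R, 0%R; split; ring.
  by rewrite Pexp !mul0r mul1r => /ordC.
exists T, A, B; split=> //.
- exact: model_rel model.
- exact: model_gen model.
apply: (model_nil_class model zN2 ordA) (pgroup_nil pT).
rewrite EL -EN -mulnA dvdn_pmul2l ?(ltnW N1) //.
apply: contraL (_ : coprime p (u * u)); last by rewrite coprimeMr cpu.
rewrite prime_coprime // negbK; apply: dvdn_trans.
by rewrite /Q -(@prednK (l - m)) ?subn_gt0 // expnS dvdn_mulr.
Qed.

(** * Conclusion *)

Lemma logn_congr (p k : nat) (a : int) (b : nat) :
    prime p -> logn p (absz a) = k -> (a != 0)%R -> ((p ^ k.+1)%N %| (a - b%:Z)%R)%Z ->
  0 < b /\ logn p b = k.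
Proof.
move=> p_pr la a0 dab; have na0 : 0 < absz a by rewrite absz_gt0.
have dvd j : j <= k.+1 -> (p ^ j %| absz a) = (p ^ j %| b)%N.
  move=> jk; have dj : ((p ^ j)%N %| (a - b%:Z)%R)%Z.
    by apply: dvdz_trans dab; rewrite dvdzE !absz_nat dvdn_exp2l.
  have E1 : (b%:Z = a - (a - b%:Z))%R by rewrite subKr.
  have E2 : (a = b%:Z + (a - b%:Z))%R by rewrite addrC subrK.
  change (((p ^ j)%N %| a)%Z = ((p ^ j)%N %| Posz b)%Z).
  by apply/idP/idP => dj'; [rewrite E1 rpredB | rewrite E2 rpredD].
have b0 : 0 < b.
  rewrite lt0n; apply/eqP=> b_0; have := dvd k.+1 (leqnn _).
  by rewrite b_0 dvdn0 pfactor_dvdn // la ltnn.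
split=> //; apply/eqP; rewrite eqn_leq -[k in _ <= k <= _]la.
rewrite -(pfactor_dvdn _ p_pr b0) -dvd // la // pfactor_dvdn // la leqnn andbT leqNgt.
by rewrite -(pfactor_dvdn _ p_pr b0) -dvd // pfactor_dvdn // la ltnn.
Qed.

Lemma zexpg_congr (gT : finGroupType) (g : gT) (k : int) (n : nat) :
  (#[g] %| (k - n%:Z)%R)%Z -> zexpg g k = g ^+ n.
Proof.
by rewrite -zexpg_eq1 => /eqP E1; rewrite -[k](subrK (Posz n)) zexpgD E1 mul1g.
Qed.

Lemma GRel_macd (gT : finGroupType) (alpha beta : int) x y (A B : gT) :
    (#[A] %| (alpha - x.+1%:Z)%R)%Z -> (#[B] %| (beta - y.+1%:Z)%R)%Z ->
  GRel alpha beta A B <-> macd x y A B.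
Proof.
move=> Ax By; rewrite /GRel (zexpg_congr Ax) (zexpg_congr By).
by split=> [/andP[/eqP ? /eqP ?]|[-> ->]]; rewrite ?eqxx.
Qed.

(* Exponents only matter modulo the orders of A and B, so alpha and beta may be
   replaced by naturals with alpha > beta that are congruent to them modulo M. *)
Lemma nat_representatives (p m l M : nat) (alpha beta : int) :
    prime p -> logn p (absz (alpha - 1)%R) = m -> logn p (absz (beta - 1)%R) = m ->
    0 < m < l -> logn p (absz (alpha - beta)%R) = l -> p ^ l.+1 %| M -> 0 < M ->
  exists x y : nat,
    [/\ (M %| (alpha - x.+1%:Z)%R)%Z, (M %| (beta - y.+1%:Z)%R)%Z, 0 < y < x,
        logn p x = m /\ logn p y = m & logn p (x - y) = l].
Proof.
move=> p_pr la lb /andP[m0 ml] lab pM M0.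
have nz (z : int) k : 0 < k -> logn p (absz z) = k -> (z != 0)%R.
  by move=> k0 lz; apply: contraTneq k0 => z0; rewrite -lz z0 logn0.
have M0' : (M%:Z != 0)%R by rewrite eqz_nat -lt0n.
pose y := absz ((beta - 1)%R %% M)%Z.
pose x := (absz ((alpha - 1)%R %% M)%Z + M)%N.
have Ey : (y%:Z = ((beta - 1) %% M)%Z)%R by rewrite gez0_abs // modz_ge0.
have Ex : (x%:Z = ((alpha - 1) %% M)%Z + M%:Z)%R by rewrite PoszD gez0_abs // modz_ge0.
have yM : y < M.
  by rewrite -ltz_nat Ey ltz_mod.
have dy : (M %| (beta - 1 - y%:Z)%R)%Z.
  by rewrite Ey {1}(divz_eq (beta - 1)%R M) addrK dvdz_mull.
have dx : (M %| (alpha - 1 - x%:Z)%R)%Z.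
  rewrite Ex {1}(divz_eq (alpha - 1)%R M) opprD addrA addrK.
  by rewrite rpredB ?dvdz_mull.
have yx : y < x by apply: leq_trans yM (leq_addl _ _).
have pdvd k (z : int) : k <= l -> (M %| z)%Z -> ((p ^ k.+1)%N %| z)%Z.
  by move=> kl; apply: dvdz_trans; rewrite dvdzE !absz_nat (dvdn_trans _ pM) ?dvdn_exp2l.
have [x0 lx] := logn_congr p_pr la (nz _ _ m0 la) (pdvd _ _ (ltnW ml) dx).
have [y0 ly] := logn_congr p_pr lb (nz _ _ m0 lb) (pdvd _ _ (ltnW ml) dy).
have dxy : (M %| (alpha - beta - (x - y)%N%:Z)%R)%Z.
  rewrite -subzn; last exact: ltnW.
  have -> : (alpha - beta - (x%:Z - y%:Z) = (alpha - 1 - x%:Z) - (beta - 1 - y%:Z))%R by ring.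
  exact: rpredB.
have l0 : 0 < l by apply: ltn_trans ml.
have [_ lxy] := logn_congr p_pr lab (nz _ _ l0 lab) (pdvd _ _ (leqnn l) dxy).
exists x, y; split; rewrite ?y0 //.
  by rewrite intS opprD addrA.
by rewrite intS opprD addrA.
Qed.

(** As G is nilpotent, its quotient by the p'-core is a p-group whose order is the p-part of that of
    G. The relations pass to it, so [macd_order_bound] applies. *)
Lemma sylow_bound_macd (gT : finGroupType) (G : {group gT}) (p m l x y : nat) (A B : gT) :
    prime p -> odd p -> G :=: <<[set A; B]>> -> macd x y A B ->
    0 < y < x -> logn p x = m -> logn p y = m -> logn p (x - y) = l ->
    1 < m -> m < l -> l < 2 * m -> 3 * m < 2 * l ->
  (#|G|`_p)%N <= p ^ (5 * m + l).
Proof.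
move=> p_pr p_odd defG rel /andP[y0 yx] lx ly lxy m1 ml l2m m3l2.
have nilG := macd_nilpotent defG rel.
have AG : A \in G by rewrite defG mem_gen // !inE eqxx.
have BG : B \in G by rewrite defG mem_gen // !inE eqxx orbT.
set H := 'O_p^'(G)%G; have nHG : G \subset 'N(H) := gFnorm _ _.
have hallH : p^'.-Hall(G) H := nilpotent_pcore_Hall _ nilG.
have cardGH : #|G / H| = (#|G|`_p)%N.
  rewrite card_quotient // -divgS ?pcore_sub // (card_Hall hallH).
  by rewrite -{1}(partnC p (cardG_gt0 G)) mulnK // part_gt0.
have pGH : p.-group (G / H) by rewrite /pgroup cardGH part_pnat.
have [nA nB] := (subsetP nHG A AG, subsetP nHG B BG).
have relH := macd_morph (coset_morphism H) nA nB rel.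
rewrite -cardGH.
exact: (macd_order_bound p_pr p_odd pGH (quotient_gen2 defG nA nB) relH).
Qed.

(** The image of a Sylow subgroup is Sylow in the image, so P maps onto the p-group, and the bound
    on orders makes this map injective. The p-part of g lies in P, and its image is the p-part of f
    g, that is f g itself. *)
Lemma macd_sylow_isog (gT rT : finGroupType) (G P : {group gT}) (f : {morphism G >-> rT})
    (p : nat) : 
    nilpotent G -> f @* G = [set: rT] -> p.-group [set: rT] -> (#|G|`_p)%N <= #|rT| ->
    p.-Sylow(G) P ->
  [/\ P \isog [set: rT] & forall g, g \in G -> p.-elt (f g) -> #[g.`_p] = #[f g]].
Proof.
move=> nilG fG pT leG sylP; have sPG := pHall_sub sylP.
have fP : f @* P = [set: rT].
  have := morphim_pHall f sPG sylP; rewrite fG => sylT.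
  by apply/eqP; rewrite eqEcard subsetT (card_Hall sylT) (part_pnat_id pT) leqnn.
pose g := restrm sPG f.
have gP : g @* P = [set: rT] by rewrite morphim_restrm setIid fP.
have injg : 'injm g.
  rewrite -card_im_injm gP cardsT (card_Hall sylP) eqn_leq leG andbT.
  by rewrite -cardsT -fP -(card_Hall sylP) leq_morphim.
split; first by apply/isogP; exists g.
move=> z zG pz; have zP : z.`_p \in P.
  rewrite (nilpotent_Hall_pcore nilG sylP) (mem_Hall_pcore (nilpotent_pcore_Hall _ nilG)).
    exact: p_elt_constt.
  by rewrite groupX.
rewrite -(order_injm injg zP) /= /restrm morph_constt //.
by rewrite constt_p_elt.
Qed.

Local Close Scope group_scope.

Theorem theorem7p3 (p : nat) (alpha beta : int)
    (gT : finGroupType) (G : {group gT}) (A B : gT) :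
  prime p -> alpha != 1%R -> beta != 1%R ->
  (3 < p \/ (p = 3 /\ (alpha != 7 %[mod 9])%Z /\ (beta != 7 %[mod 9])%Z)) ->
  is_Gab alpha beta G A B ->
  let m := logn p (absz (alpha - 1)%R) in
  logn p (absz (beta - 1)%R) = m -> 0 < m ->
  let l := logn p (absz (alpha - beta)%R) in
  m < l < 2 * m -> 3 * m < 2 * l ->
  let a := (A.`_p)%g in let b := (B.`_p)%g in let c := (([~ A, B]).`_p)%g in
  (forall P : {group gT}, P \in ('Syl_p(G))%g ->
      #|P| = p ^ (5 * m + l) /\ nil_class P = 5) /\
  #[a]%g = p ^ (m + l) /\ #[b]%g = p ^ (m + l) /\ #[c]%g = p ^ (2 * m).
Proof.
move=> p_pr _ _ p3 [defG relG univG] m lb m0 l /andP[ml l2m] m3l2 a b c.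
have p_odd : odd p.
  by case: p3 => [p3|[-> //]]; case: (even_prime p_pr) => // p2; rewrite p2 in p3.
have p0 := prime_gt0 p_pr; have m1 : 1 < m by lia.
have AG : A \in G by rewrite defG mem_gen // !inE eqxx.
have BG : B \in G by rewrite defG mem_gen // !inE eqxx orbT.
(* M is a multiple of all orders in G and of p^(m+l), the order of the generators of the model, so
   one pair x, y represents alpha and beta in both groups. It is also divisible by p^(l+1), so the
   valuations m and l are preserved. *)
pose M := #|G| * p ^ (m + l).
have M0 : 0 < M by rewrite muln_gt0 cardG_gt0 expn_gt0 p0.
have pM : p ^ l.+1 %| M by rewrite dvdn_mull // dvdn_exp2l // -add1n leq_add2r.
have m0l : 0 < m < l by rewrite m0.
have [x [y [dx dy yx [lx ly] lxy]]] := nat_representatives p_pr erefl lb m0l erefl pM M0.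
have dvdM (rT : finGroupType) (g : rT) z : #[g]%g %| M -> (M %| z)%Z -> (#[g]%g %| z)%Z.
  by move=> gM; apply: dvdz_trans.
have GM (g : gT) : g \in G -> #[g]%g %| M.
  by move=> gG; apply: dvdn_mulr; apply: order_dvdG.
have rel : macd x y A B.
  by apply/(GRel_macd (alpha := alpha) (beta := beta)) => //; apply: dvdM; rewrite ?GM.
have x0 : 0 < x by case/andP: yx => ?; apply: leq_trans.
have y0 : 0 < y by case/andP: yx.
have [u cpu Eu] := logn_split p_pr x0 lx.
have [v cpv Ev] := logn_split p_pr y0 ly.
have xy0 : 0 < x - y by rewrite subn_gt0; case/andP: yx.
have [d _ Ed] := logn_split p_pr xy0 lxy.
have Euv : u = v + p ^ (l - m) * d.
  apply/eqP; rewrite -(@eqn_pmul2l (p ^ m)) ?expn_gt0 ?p0 // mulnDr -Eu -Ev mulnA -expnD.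
  by rewrite subnKC ?(ltnW ml) // -Ed subnKC //; case/andP: yx => _ /ltnW.
have [T [A' [B' [rel' defT cardT classT [oA oB oC]]]]] :=
  macd_p_model p_pr p_odd ml l2m m3l2 cpu cpv Euv.
have [f [fA fB]] : exists f : {morphism G >-> T}, f A = A' /\ f B = B'.
  apply: univG; rewrite -Eu -Ev in rel'.
  by apply/(GRel_macd (x := x) (y := y)) => //; apply: dvdM; rewrite ?oA ?oB ?dvdn_mull.
have nilG := macd_nilpotent defG rel.
have fG : (f @* G)%g = [set: T] 
  by rewrite (congr1 (fun E => f @* E)%g defG) morphim_gen2 // fA fB.
have leG : #|G|`_p <= #|T|.
  by rewrite cardT; apply: sylow_bound_macd defG rel yx lx ly lxy m1 ml l2m m3l2.
have pT : (p.-group [set: T])%g by rewrite /pgroup cardsT cardT pnatX pnat_id.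
have iso := macd_sylow_isog nilG fG pT leG.
have pelt (g : T) : (p.-elt g)%g by apply: mem_p_elt pT _; rewrite inE.
split.
  move=> P; rewrite inE => /iso[isoP _].
  by rewrite (card_isog isoP) (isog_nil_class isoP) cardsT cardT classT.
have [P sylP] := Sylow_exists p G; have [_ ordP] := iso _ sylP.
rewrite /a /b /c !ordP ?groupR //.
by rewrite morphR // fA fB oA oB oC.
Qed.
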